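(* The following hold. (i) Let $k\geq 2$. The real Bott manifolds of the form $M(A)=S^1\times_{\mathbb{Z}_2}M(B)$ with $M(B)=T^k\times_{(\mathbb{Z}_2)^s}T^2$ for some $s\in\{1,2\}$ form exactly $3$ diffeomorphism classes. Likewise, the real Bott manifolds of the form $M(A)=S^1\times_{\mathbb{Z}_2}M(B)$ with $M(B)=T^k\times_{(\mathbb{Z}_2)^s}K$ for some $s\in\{1,2\}$, where $K$ is the Klein bottle, form exactly $3$ diffeomorphism classes. (ii) Let $t\geq 2$. The real Bott manifolds of the form $M(A)=S^1\times_{\mathbb{Z}_2}M(B)$ with $M(B)=S^1\times_{\mathbb{Z}_2}T^t$ form exactly $\left[\frac t2\right]+1$ diffeomorphism classes, where $[x]$ denotes the greatest integer not exceeding $x$. (iii) For any $n\geq 2$ and $1\le k\le n-1$, the real Bott manifolds of the form $M(A)=T^k\times_{\mathbb{Z}_2}T^{n-k}$ form exactly one diffeomorphism class.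
   Context: A Bott matrix of size $n$ is an $n\times n$ upper triangular matrix $A=(a_{ij})$ with $a_{ii}=1$ for all $i$ and $a_{ij}\in\{0,1\}$ for $i<j$. Let $S^1\subset\mathbb{C}$ be the unit circle and $T^n=(S^1)^n$. A Bott matrix $A$ defines a free action of $(\mathbb{Z}_2)^n=\langle g_1,\dots,g_n\rangle$ on $T^n$ by $$g_i(z_1,\dots,z_n)=(z_1,\dots,z_{i-1},-z_i,\tilde z_{i+1},\dots,\tilde z_n),$$ where for $j>i$, $\tilde z_j=\bar z_j$ if $a_{ij}=1$ and $\tilde z_j=z_j$ if $a_{ij}=0$. The quotient smooth manifold $M(A)=T^n/(\mathbb{Z}_2)^n$ is called an ($n$-dimensional) real Bott manifold. For instance $M(I_n)$ is the torus $T^n$, and $M\begin{pmatrix}1&1\\0&1\end{pmatrix}$ is the Klein bottle $K$. Let $k$ be the number of columns of $A$ whose only nonzero entry is the diagonal entry. Moving these columns (and simultaneously the corresponding rows) to the front, which does not change the diffeomorphism class of $M(A)$, brings $A$ to the form $\begin{pmatrix} I_k & C\\ 0& B\end{pmatrix}$, where $B$ is a Bott matrix of size $n-k$ and each of the last $n-k$ columns has at least two nonzero entries. Each row $(c_1,\dots,c_{n-k})$ of $C$ acts on $M(B)$ by $[z_1,\dots,z_{n-k}]\mapsto[\tilde z_1,\dots,\tilde z_{n-k}]$, with $\tilde z_j=\bar z_j$ if $c_j=1$ and $\tilde z_j=z_j$ if $c_j=0$. The group of transformations of $M(B)$ generated by the rows of $C$ is isomorphic to $(\mathbb{Z}_2)^s$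 with $s=\operatorname{rank}_{\mathbb{F}_2}C$. In this situation one writes $M(A)=T^k\times_{(\mathbb{Z}_2)^s}M(B)$ (and $S^1$ for $T^1$, $\mathbb{Z}_2$ for $(\mathbb{Z}_2)^1$). Here $k$, $s$ and the diffeomorphism type of $M(B)$ are diffeomorphism invariants of $M(A)$. *)

(* Defs.v *)
From HB Require Import structures.
From mathcomp Require Import all_boot all_order all_algebra all_fingroup.
From mathcomp.real_closed Require Import complex.
From mathcomp Require Import all_classical all_reals all_analysis.
Import Order.TTheory GRing.Theory Num.Theory.
Import numFieldNormedType.Exports.

Set Implicit Arguments.
Unset Strict Implicit.
Unset Printing Implicit Defensive.

Local Open Scope ring_scope.
Local Open Scope quotient_scope.

(* The entries lie in 'F_2, so they are 0 or 1, and \rank of such a matrix is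
   its rank over F_2. *)
Definition bott_matrix n (A : 'M['F_2]_n) : Prop :=
  (forall i, A i i = 1) /\ (forall i j : 'I_n, (j < i)%N -> A i j = 0).

Section RealBottManifold.
Variable R : realType.

Definition circle := {z : R[i] | `|z| == 1}.

Fact circle_opp_subproof (z : circle) : `|- val z| == 1.
Proof. by rewrite normrN (valP z). Qed.

Fact circle_conj_subproof (z : circle) : `|(val z)^*| == 1.
Proof. by rewrite norm_conjC (valP z). Qed.

Fact circle_exp_subproof (x : R) : `|(cos x +i* sin x)%C| == 1.
Proof. by rewrite normc_def /= cos2Dsin2 sqrtr1. Qed.

Definition circle_opp (z : circle) : circle :=
  exist _ (- val z) (circle_opp_subproof z).
Definition circle_conj (z : circle) : circle :=
  exist _ (val z)^* (circle_conj_subproof z).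
Definition circle_exp (x : R) : circle :=
  exist _ (cos x +i* sin x)%C (circle_exp_subproof x).

Definition torus n := {ffun 'I_n -> circle}.

Section Quotient.
Variables (n : nat) (A : 'M['F_2]_n).

(* The transformation g_i of the torus. *)
Definition bott_gen (i : 'I_n) (z : torus n) : torus n :=
  [ffun j => if j == i then circle_opp (z j)
             else if (i < j)%N && (A i j == 1) then circle_conj (z j)
             else z j].

Lemma bott_genK i : involutive (bott_gen i).
Proof.
move=> z; apply/ffunP => j; rewrite !ffunE.
case: eqP => _; first by apply: val_inj; rewrite /= opprK.
by case: (_ && _) => //; apply: val_inj; rewrite /= conjCK.
Qed.

(* Two points are related when some word in the g_i maps the first to the
   second; the g_i being involutions, words without inverses exhaust the group
   they generate. *)
Definition bott_orbit_rel : rel (torus n) := fun z w =>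
  `[< exists s : seq 'I_n, w = foldr bott_gen z s >].

Lemma bott_orbit_refl : reflexive bott_orbit_rel.
Proof. by move=> z; apply/asboolP; exists [::]. Qed.

Lemma bott_orbit_trans : transitive bott_orbit_rel.
Proof.
move=> y x z /asboolP[s ->] /asboolP[t ->].
by apply/asboolP; exists (t ++ s); rewrite foldr_cat.
Qed.

Lemma bott_orbit_sym : symmetric bott_orbit_rel.
Proof.
suff H x y : bott_orbit_rel x y -> bott_orbit_rel y x.
  by move=> x y; apply/idP/idP; apply: H.
move=> /asboolP[s ->]; elim: s => [|i s IHs] /=; first exact: bott_orbit_refl.
apply: bott_orbit_trans IHs; apply/asboolP; exists [:: i].
by rewrite /= bott_genK.
Qed.

Canonical bott_orbit_equiv :=
  EquivRel bott_orbit_rel bott_orbit_refl bott_orbit_sym bott_orbit_trans.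

(* M(A) *)
Definition real_bott : Type := {eq_quot bott_orbit_rel}.

(* The map R^n -> T^n -> M(A), x |-> [exp(i x_1), ..., exp(i x_n)]; both
   factors are coverings. *)
Definition real_bott_param (x : 'rV[R]_n) : real_bott :=
  \pi_({eq_quot bott_orbit_rel}) [ffun j => circle_exp (x 0 j)].

(* The smooth structure of M(A) is the one making T^n -> M(A), hence also
   R^n -> M(A), a local diffeomorphism: the inverses of the restrictions of
   [real_bott_param] to the open sets on which it is injective form an atlas. *)
Definition chart_domain (U : set 'rV[R]_n) : Prop :=
  open U /\ {in U &, injective real_bott_param}.

End Quotient.

(* C^k maps on an open set; only the values of f on U matter, because
   derivatives are local. *)
Fixpoint Ck_on (V W : normedModType R) (k : nat) (U : set V) (f : V -> W) :
    Prop :=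
  if k is k'.+1 then
    (forall x, U x -> differentiable f x) /\
    (forall v, Ck_on k' U (fun x => 'D_v f x))
  else forall x, U x -> {for x, continuous f}.

Definition smooth_on (V W : normedModType R) (U : set V) (f : V -> W) : Prop :=
  forall k, Ck_on k U f.

(* F is f read in the charts with domains U and V. *)
Definition smooth_map n (A B : 'M['F_2]_n) (f : real_bott A -> real_bott B) :
    Prop :=
  forall p : real_bott A,
  exists (U V : set 'rV[R]_n) (F : 'rV[R]_n -> 'rV[R]_n),
    [/\ chart_domain A U, chart_domain B V,
        exists2 x, U x & real_bott_param A x = p,
        smooth_on U F &
        forall x, U x ->
          V (F x) /\ real_bott_param B (F x) = f (real_bott_param A x)].

Definition diffeomorphic n (A B : 'M['F_2]_n) : Prop :=
  exists (f : real_bott A -> real_bott B) (g : real_bott B -> real_bott A),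
    [/\ cancel f g, cancel g f, smooth_map f & smooth_map g].

(* The number of diffeomorphism classes of the manifolds M(A), for A of size n
   such that P A. *)
Definition num_diffeo_classes n (P : 'M['F_2]_n -> Prop) : nat :=
  #|equivalence_partition (fun A B => `[< diffeomorphic A B >])
                          (finset (fun A => `[< P A >]))|.

End RealBottManifold.

(* M(A) = T^k x_{(Z_2)^s} M(B) with X B, for A of size k + m: the simultaneous
   permutation of columns and rows by sigma, which preserves the order inside
   each of the two blocks, moves to the front the columns of A whose only
   nonzero entry is the diagonal one. The last m columns of the result have at
   least two nonzero entries, so there are exactly k such columns, and sigma, C
   and B are determined by A. *)
Definition twisted_product (k s m : nat) (X : 'M['F_2]_m -> Prop)
    (A : 'M['F_2]_(k + m)) : Prop :=
  bott_matrix A /\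
  exists (sigma : 'S_(k + m)) (C : 'M['F_2]_(k, m)) (B : 'M['F_2]_m),
    [/\ (forall i j : 'I_k, (i < j)%N ->
           (sigma (lshift m i) < sigma (lshift m j))%N) /\
        (forall i j : 'I_m, (i < j)%N ->
           (sigma (rshift k i) < sigma (rshift k j))%N),
        mxsub sigma sigma A = block_mx 1%:M C 0 B,
        forall j : 'I_m, (1 < #|[pred i | col_mx C B i j != 0%R]|)%N,
        \rank C = s &
        X B].

(* "M(B) is the torus T^m" *)
Definition is_torus (R : realType) m (B : 'M['F_2]_m) : Prop :=
  bott_matrix B /\ diffeomorphic R B 1%:M.

(* "M(B) is the Klein bottle" *)
Definition is_klein_bottle (R : realType) (B : 'M['F_2]_2) : Prop :=
  bott_matrix B /\
  diffeomorphic R B (\matrix_(i < 2, j < 2) (i <= j)%N%:R).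

(* Main.v *)
(* M(A) is the quotient of R^n by the group of the maps
   x_i |-> (-1)^(sum_j A_ji k_j) x_i + pi k_i with k in Z^n. Explicit affine
   maps (permutations of the coordinates, integral shears between coordinates
   with the same holonomy, translations by pi/2) conjugate the group of every
   manifold under consideration to that of one of finitely many normal forms.
   Conversely a diffeomorphism lifts to R^n and so induces an isomorphism of
   these groups, hence a linear isomorphism between the spaces H^1(-; F_2) that
   preserves the pairs of classes with zero product; such pairs are described
   by the quadratic equations [zp]. The normal forms are told apart as follows.
   The nonzero pairs (u, v) with u v = 0 have as sums u + v exactly the columns
   of A - 1. For the fiber T^2 one uses the additive structure of the set of
   these sums, for the fiber K also which of them are zero divisors, and in (ii)
   the largest dimension of a space {u | u^2 = a u}. *)

Require Import Defs.
From mathcomp Require Import all_boot all_order all_algebra perm.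
From mathcomp.real_closed Require Import complex.
From mathcomp Require Import all_classical all_reals all_analysis.
From mathcomp Require Import ring lra zify.
Import Order.TTheory GRing.Theory Num.Theory.
Import numFieldNormedType.Exports.

Set Implicit Arguments.
Unset Strict Implicit.
Unset Printing Implicit Defensive.

Local Open Scope ring_scope.
Local Open Scope quotient_scope.

(** * The deformed group structures on Z^I *)

(** The passage from a diffeomorphism to algebra rests on a metric fact: for the sup norm the group
    acts by isometries, and distinct images of one point are at least pi apart. A point of a fibre
    is thus determined by an approximation better than pi / 2, so a map lifts by small steps along
    rays from the origin as soon as it is uniformly continuous, which compactness provides. Two
    lifts of one map differ by a single group element. H^1 is handled as the set of homomorphisms to
    F_2, and u v = 0 as the existence of a function on the group whose coboundary is the product
    cocycle. Both notions refer to the group alone, hence are invariant; commuting two generators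
    turns the second one into the equations [zp]. Index sets are arbitrary finite types because the
    normal forms live on sums such as ['I_1 + ('I_k + 'I_2)], where reordering coordinates costs
    nothing; [acyclic] stands there for triangularity. *)

Lemma F2P (a : 'F_2) : a = 0 \/ a = 1.
Proof. by case: a => [[|[|//]] i]; [left|right]; apply: val_inj. Qed.

Lemma F2_1_neq0 : (1 : 'F_2) <> 0.
Proof. by apply/eqP; rewrite oner_eq0. Qed.

Lemma F2_two : 2%:~R = 0 :> 'F_2.
Proof. exact: val_inj. Qed.

Lemma F2_neq0 (a : 'F_2) : a <> 0 -> a = 1.
Proof. by case: (F2P a). Qed.

Lemma F2D (a : 'F_2) : a + a = 0.
Proof. by case: (F2P a) => ->; apply: val_inj. Qed.

Lemma F2N (a : 'F_2) : - a = a.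
Proof. by apply/eqP; rewrite eq_sym -subr_eq0 opprK F2D. Qed.

Lemma F2_mulK (a : 'F_2) : a * a = a.
Proof. by case: (F2P a) => ->; rewrite ?mulr0 ?mulr1. Qed.

Definition sgn2 (a : 'F_2) : int := if a == 0 then 1 else -1.

Lemma sgn2_0 : sgn2 0 = 1. Proof. by []. Qed.

Lemma sgn2_1 : sgn2 1 = -1. Proof. by []. Qed.

Lemma sgn2D a b : sgn2 (a + b) = sgn2 a * sgn2 b.
Proof.
by case: (F2P a) => ->; case: (F2P b) => ->; rewrite ?addr0 ?add0r ?F2D.
Qed.

Lemma sgn2_sq a : sgn2 a * sgn2 a = 1.
Proof. by rewrite -sgn2D F2D. Qed.

Lemma sgn2_F2 a : (sgn2 a)%:~R = 1 :> 'F_2.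
Proof. by case: (F2P a) => ->; apply: val_inj. Qed.

(* [N j i = 1] means that the j-th generator conjugates the i-th coordinate;
   the element k of the deformed group Z^I acts on R^I as in [act]. *)
Section Group.
Variables (I : finType) (N : I -> I -> 'F_2).
Implicit Types (k l m : I -> int) (u v : I -> 'F_2).

Definition hol k (i : I) : 'F_2 := \sum_j N j i * (k j)%:~R.

Definition gmul k l : I -> int := fun i => k i + sgn2 (hol k i) * l i.
Definition gone : I -> int := fun=> 0.
Definition ginv k : I -> int := fun i => - (sgn2 (hol k i) * k i).

Definition chi u k : 'F_2 := \sum_i u i * (k i)%:~R.

Lemma hol_gmul k l i : hol (gmul k l) i = hol k i + hol l i.
Proof.
rewrite /hol -big_split /=; apply: eq_bigr => j _.
by rewrite /gmul intrD intrM sgn2_F2 mul1r mulrDr.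
Qed.

Lemma hol_gone i : hol gone i = 0.
Proof. by rewrite /hol big1 // => j _; rewrite mulr0. Qed.

Lemma hol_ginv k i : hol (ginv k) i = hol k i.
Proof.
apply: eq_bigr => j _; congr (_ * _).
by rewrite /ginv intrN intrM sgn2_F2 mul1r F2N.
Qed.

Lemma gmulA k l m : gmul k (gmul l m) = gmul (gmul k l) m.
Proof.
by apply/funext => i; rewrite /gmul -/(gmul k l) hol_gmul sgn2D; ring.
Qed.

Lemma gmul1 k : gmul k gone = k.
Proof. by apply/funext => i; rewrite /gmul mulr0 addr0. Qed.

Lemma gone_mul k : gmul gone k = k.
Proof. by apply/funext => i; rewrite /gmul hol_gone add0r mul1r. Qed.

Lemma gmulV k : gmul k (ginv k) = gone.
Proof.
by apply/funext => i; rewrite /gmul /ginv mulrN mulrA sgn2_sq mul1r subrr.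
Qed.

Lemma gmulVl k : gmul (ginv k) k = gone.
Proof. by apply/funext => i; rewrite /gmul hol_ginv /ginv addNr. Qed.

(** Signs are invisible modulo 2, so the deformation of the group law leaves the characters of Z^I
    with values in F_2 unchanged. *)
Lemma chi_gmul u k l : chi u (gmul k l) = chi u k + chi u l.
Proof.
rewrite /chi -big_split /=; apply: eq_bigr => j _.
by rewrite /gmul intrD intrM sgn2_F2 mul1r mulrDr.
Qed.

Definition unit_at (i : I) (c : int) : I -> int :=
  fun j => if j == i then c else 0.

Lemma chi_unit u i c : chi u (unit_at i c) = u i * c%:~R.
Proof.
rewrite /chi (bigD1 i) //= /unit_at eqxx big1 ?addr0 // => j /negPf ->.
by rewrite mulr0.
Qed.

Lemma hol_unit i c j : hol (unit_at i c) j = N i j * c%:~R.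
Proof.
rewrite /hol (bigD1 i) //= /unit_at eqxx big1 ?addr0 // => h /negPf ->.
by rewrite mulr0.
Qed.

Hypothesis Nii : forall i, N i i = 0.

Lemma gmul_unit k i c :
  gmul k (unit_at i c) = (fun j => k j + unit_at i (sgn2 (hol k i) * c) j).
Proof.
apply/funext => j; rewrite /gmul /unit_at.
by case: eqP => [->|]; rewrite ?mulr0.
Qed.

Lemma gmul_unit2 i c d :
  gmul (unit_at i c) (unit_at i d) = unit_at i (c + d).
Proof.
rewrite gmul_unit hol_unit Nii mul0r mul1r.
by apply/funext => j; rewrite /unit_at; case: eqP.
Qed.

(* The group is generated by the [unit_at i 1]. *)
Lemma hom_chi (f : (I -> int) -> 'F_2) :
  (forall k l, f (gmul k l) = f k + f l) ->
  forall k, f k = chi (fun i => f (unit_at i 1)) k.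
Proof.
move=> fM.
have f1 : f gone = 0.
  by have := fM gone gone; rewrite gmul1 F2D.
have u0 i : unit_at i 0 = gone.
  by apply/funext => j; rewrite /unit_at; case: eqP.
have fpos i (c : nat) : f (unit_at i c%:Z) = f (unit_at i 1) * (c%:Z)%:~R.
  elim: c => [|c IH]; first by rewrite u0 f1 mulr0.
  by rewrite -[c.+1]addn1 PoszD -gmul_unit2 fM IH intrD mulrDr mulr1.
have fN i c : f (unit_at i (- c)) = f (unit_at i c).
  apply/eqP; rewrite -subr_eq0 F2N -fM.
  by rewrite gmul_unit2 addNr u0 f1.
have fu i c : f (unit_at i c) = f (unit_at i 1) * c%:~R.
  case: (intP c) => [|n|n]; first by rewrite u0 f1 mulr0.
    exact: fpos.
  by rewrite fN fpos intrN F2N.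
have fs i s c : f (unit_at i (sgn2 s * c)) = f (unit_at i 1) * c%:~R.
  by rewrite fu intrM sgn2_F2 mul1r.
(* Right multiplication by a unit at i twists its entry by the holonomy of k; giving the entry the
   same sign beforehand cancels the twist. *)
have key k l i c : l = (fun j => k j + unit_at i c j) ->
    f l = f k + f (unit_at i 1) * c%:~R.
  move=> ->.
  have := gmul_unit k i (sgn2 (hol k i) * c).
  by rewrite mulrA sgn2_sq mul1r => <-; rewrite fM fs.
move=> k.
have H (s : seq I) : uniq s -> f (fun j => if j \in s then k j else 0) =
    \sum_(i <- s) f (unit_at i 1) * (k i)%:~R.
  elim: s => [ _ | i s IH /= /andP[si us]].
    by rewrite big_nil -[RHS]f1; congr f; apply/funext => j; rewrite in_nil.
  rewrite big_cons addrC -IH //; apply: key; apply/funext => j.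
  rewrite inE /unit_at; case: eqP => [-> | _]; last by rewrite addr0.
  by rewrite (negPf si) add0r.
rewrite /chi -big_enum -H ?enum_uniq //.
by congr f; apply/funext => j; rewrite mem_enum.
Qed.

End Group.

(** * Isomorphisms and products of degree one classes *)

Definition grpiso (I J : finType) (N : I -> I -> 'F_2) (N' : J -> J -> 'F_2) :=
  exists phi psi, [/\ cancel phi psi, cancel psi phi &
    forall k l, phi (gmul N k l) = gmul N' (phi k) (phi l)].

Section GrpIso.
Variables (I J K : finType).
Variables (N : I -> I -> 'F_2) (N' : J -> J -> 'F_2) (N'' : K -> K -> 'F_2).

Lemma grpiso_sym : grpiso N N' -> grpiso N' N.
Proof.
move=> [f [g [fK gK fM]]]; exists g, f; split => // k l.
by apply: (can_inj fK); rewrite fM !gK.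
Qed.

Lemma grpiso_trans : grpiso N N' -> grpiso N' N'' -> grpiso N N''.
Proof.
move=> [f [g [fK gK fM]]] [f' [g' [fK' gK' fM']]].
exists (f' \o f), (g \o g'); split; [exact: can_comp|exact: can_comp|].
by move=> k l /=; rewrite fM fM'.
Qed.

End GrpIso.

(* Vanishing of the cup product of the classes in H^1(-; F_2) of u and v *)
Definition cobounds (I : finType) (N : I -> I -> 'F_2) (u v : I -> 'F_2) :=
  exists f : (I -> int) -> 'F_2,
    forall k l, f (gmul N k l) = f k + f l + chi u k * chi v l.

(* With H^*(M(A); F_2) = F_2[x_1, ..., x_n] / (x_j^2 = x_j sum_(i<j) A_ij x_i),
   this says that the product of sum_i u_i x_i and sum_i v_i x_i is zero. Written
   symmetrically in i and j, it makes sense for an unordered index set. *)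
Definition zp (I : finType) (N : I -> I -> 'F_2) (u v : I -> 'F_2) :=
  forall i j, i != j ->
    u i * v j + u j * v i = N i j * (u j * v j) + N j i * (u i * v i).

(** The rank [r] is an order of the coordinates for which N is strictly upper triangular, on an
    index set that carries no order of its own. *)
Definition acyclic (I : finType) (N : I -> I -> 'F_2) :=
  exists r : I -> nat, injective r /\ forall i j, N i j <> 0 -> (r i < r j)%N.

Lemma F2_neq1 (a : 'F_2) : ~ a <> 0 -> a = 0.
Proof. by case: (F2P a) => // -> h; case: h. Qed.

Lemma acyclic_lt (I : finType) (N : I -> I -> 'F_2) (r : I -> nat) :
  (forall i j, N i j <> 0 -> (r i < r j)%N) ->
  forall i j, (r i < r j)%N -> N j i = 0.
Proof. by move=> Nr i j ij; apply: F2_neq1 => /Nr; lia. Qed.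

Lemma acyclic_diag (I : finType) (N : I -> I -> 'F_2) i :
  acyclic N -> N i i = 0.
Proof.
by move=> [r [_ Nr]]; apply: F2_neq1 => /Nr; rewrite ltnn. Qed.

(** The binomial coefficient of c over 2, modulo 2. Its coboundary is the product of parities, so it
    is a primitive for the square of a class of degree one on Z. *)
Definition bin2 (c : int) : 'F_2 := (c * (c - 1) %/ 2)%Z%:~R.

Lemma bin2D c d : bin2 (c + d) = bin2 c + bin2 d + c%:~R * d%:~R.
Proof.
rewrite /bin2 -intrM -!intrD; congr (_%:~R).
have e (z : int) : exists q, z * (z - 1) = q * 2.
  have := divz_eq z 2; have := modz_ge0 z (isT : (2 : int) != 0).
  have := ltz_pmod z (isT : 0 < (2 : int)).
  move: (z %/ 2)%Z (z %% 2)%Z => q m m2 m0 ->.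
  have [->|->] : m = 0 \/ m = 1 by lia.
    by exists (q * (q * 2 - 1)); ring.
  by exists ((q * 2 + 1) * q); ring.
have [p pe] := e c; have [q qe] := e d; rewrite pe qe.
have -> : (c + d) * (c + d - 1) = (p + q + c * d) * 2.
  by rewrite !mulrDl -pe -qe; ring.
by rewrite !mulzK.
Qed.

Lemma bin2N c : bin2 (- c) = bin2 c + c%:~R.
Proof.
have := bin2D c (- c); rewrite subrr intrN F2N F2_mulK => e.
have : bin2 c + bin2 (- c) + c%:~R = 0 by rewrite -e.
move=> /eqP; rewrite addr_eq0 F2N => /eqP <-.
by rewrite addrA F2D add0r.
Qed.

Lemma bin2_sgn s c : bin2 (sgn2 s * c) = bin2 c + s * c%:~R.
Proof.
case: (F2P s) => ->; rewrite ?sgn2_0 ?sgn2_1 ?mul1r ?mul0r ?addr0 //.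
by rewrite mulN1r bin2N.
Qed.

Section ZeroProducts.
Variables (I : finType) (N : I -> I -> 'F_2).
Hypothesis acN : acyclic N.
Implicit Types (u v : I -> 'F_2).

Let Nii i : N i i = 0. Proof. exact: acyclic_diag. Qed.

(** For r i < r j the generators satisfy e_i e_j = e_j^(+-1) e_i, with the sign given by N i j.
    Evaluating f on both sides yields the equation at (i, j); the term with N i j comes from
    f(e_j^-1) = f(e_j) + u_j v_j. *)
Lemma cobounds_zp u v : cobounds N u v -> zp N u v.
Proof.
case: acN => r [r_inj Nr] [f fM]; have N0 := acyclic_lt Nr.
suff H i j : (r i < r j)%N -> u i * v j + u j * v i = N i j * (u j * v j).
  move=> i j ij.
  have /orP[ij'|ij'] : (r i < r j)%N || (r j < r i)%N.
    by rewrite -neq_ltn; apply: contra ij => /eqP/r_inj ->.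
    by rewrite H // (N0 i j) // mul0r addr0.
  by rewrite addrC H // (N0 j i) // mul0r add0r.
move=> rij.
have Nji : N j i = 0 by exact: N0.
have ji : (i == j) = false.
  by apply/negP => /eqP e; rewrite e ltnn in rij.
have f1 : f (@gone I) = 0.
  have := fM (@gone I) (@gone I); rewrite gmul1.
  have -> : chi u (@gone I) = 0 by rewrite /chi big1 // => h _; rewrite mulr0.
  by rewrite mul0r addr0 F2D.
have fN : f (unit_at j (-1)) = f (unit_at j 1) + u j * v j.
  have := fM (unit_at j 1) (unit_at j (-1)).
  rewrite gmul_unit2 // subrr !chi_unit mulrN1 mulr1.
  have -> : unit_at j 0 = @gone I by apply/funext => h; rewrite /unit_at;
    case: ifP.
  rewrite f1 addrAC F2N => /esym/eqP; rewrite addr_eq0 F2N => /eqP e.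
  by rewrite -e.
have e1 := fM (unit_at i 1) (unit_at j 1).
have e2 := fM (unit_at j (sgn2 (N i j))) (unit_at i 1).
have e : gmul N (unit_at i 1) (unit_at j 1) =
         gmul N (unit_at j (sgn2 (N i j))) (unit_at i 1).
  rewrite !gmul_unit !hol_unit Nji mul0r mulr1 mul1r mulr1.
  by apply/funext => h; rewrite addrC.
rewrite e e2 !chi_unit !mulr1 in e1.
move: e1; rewrite sgn2_F2 mulr1.
case: (F2P (N i j)) => ->.
  rewrite sgn2_0 mul0r [f _ + f _]addrC => /addrI ->.
  by rewrite F2D.
rewrite sgn2_1 mul1r fN => e1.
have {}e1 : u j * v j + u j * v i = u i * v j.
  apply: (addrI (f (unit_at i 1) + f (unit_at j 1))).
  by rewrite -e1; ring.
by rewrite -e1 -addrA F2D addr0.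
Qed.

(** The primitive is an explicit quadratic function. In its coboundary the coefficient of k_i l_j is
    u_i v_j when r j < r i or i = j; for r i < r j it is u_j v_i + N_ij u_j v_j, where the last term
    is the effect of the sign in [bin2_sgn], and the equation at (i, j) makes it u_i v_j. *)
Lemma zp_cobounds u v : zp N u v -> cobounds N u v.
Proof.
case: acN => r [r_inj Nr] uv; have N0 := acyclic_lt Nr.
exists (fun k => \sum_i \sum_(j | (r i < r j)%N) u j * v i *
  ((k i)%:~R * (k j)%:~R)
               + \sum_i u i * v i * bin2 (k i)) => k l.
rewrite /gmul.
have -> : \sum_i u i * v i * bin2 (k i + sgn2 (hol N k i) * l i) =
  \sum_i u i * v i * bin2 (k i) + \sum_i u i * v i * bin2 (l i) +
  \sum_j \sum_i u i * v i * N j i * ((k j)%:~R * (l i)%:~R)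
  + \sum_i u i * v i * ((k i)%:~R * (l i)%:~R).
  rewrite exchange_big -!big_split /=; apply: eq_bigr => i _.
  rewrite bin2D bin2_sgn intrM sgn2_F2 mul1r /hol.
  have -> : \sum_j u i * v i * N j i * ((k j)%:~R * (l i)%:~R) =
            u i * v i * ((\sum_j N j i * (k j)%:~R) * (l i)%:~R).
    by rewrite mulr_suml mulr_sumr; apply: eq_bigr => j _; ring.
  by ring.
set S := (X in _ + _ + X * _).
have -> : \sum_i \sum_(j | (r i < r j)%N) u j * v i *
    ((k i + sgn2 (hol N k i) * l i)%:~R * (k j + sgn2 (hol N k j) * l j)%:~R) =
  \sum_i \sum_(j | (r i < r j)%N) u j * v i * ((k i)%:~R * (k j)%:~R) +
  \sum_i \sum_(j | (r i < r j)%N) u j * v i * ((l i)%:~R * (l j)%:~R) +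
  \sum_i \sum_(j | (r i < r j)%N) u j * v i * ((k i)%:~R * (l j)%:~R) +
  \sum_i \sum_(j | (r j < r i)%N) u i * v j * ((k i)%:~R * (l j)%:~R).
  rewrite [X in _ + X](exchange_big_dep predT) //= -!big_split /=.
  apply: eq_bigr => i _; rewrite -!big_split /=; apply: eq_bigr => j _.
  by rewrite !intrD !intrM !sgn2_F2; ring.
have -> : S * chi v l = \sum_i \sum_j u i * v j * ((k i)%:~R * (l j)%:~R).
  rewrite /S /chi mulr_suml; apply: eq_bigr => i _; rewrite mulr_sumr.
  by apply: eq_bigr => j _; ring.
have -> : \sum_i \sum_j u i * v j * ((k i)%:~R * (l j)%:~R) =
  \sum_i \sum_(j | (r i < r j)%N) u j * v i * ((k i)%:~R * (l j)%:~R) +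
  \sum_i \sum_(j | (r j < r i)%N) u i * v j * ((k i)%:~R * (l j)%:~R) +
  \sum_j \sum_i u i * v i * N j i * ((k j)%:~R * (l i)%:~R)
  + \sum_i u i * v i * ((k i)%:~R * (l i)%:~R).
  rewrite -!big_split /=; apply: eq_bigr => i _.
  rewrite [in RHS]big_mkcond [X in _ + X + _ + _]big_mkcond /=.
  rewrite -!big_split /= (bigD1 i) //= [in RHS](bigD1 i) //=.
  rewrite ltnn Nii mulr0 mul0r !add0r addrC; congr (_ + _).
  apply: eq_bigr => j ji.
  have := uv i j; rewrite eq_sym => /(_ ji).
  case: ltngtP => rij; last by move/r_inj: rij ji => ->; rewrite eqxx.
    rewrite (N0 _ _ rij) mul0r !addr0 => e.
    have -> : u i * v j = u j * v i + u j * v j * N i j.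
      by rewrite [u j * v j * _]mulrC -e addrCA F2D addr0.
    by ring.
  by rewrite (N0 _ _ rij) mulr0 mul0r addr0 add0r.
by ring.
Qed.

End ZeroProducts.

Definition addf (I : Type) (u v : I -> 'F_2) : I -> 'F_2 := fun i => u i + v i.
Definition zerof (I : Type) : I -> 'F_2 := fun=> 0.

Definition zpiso (I J : finType) (N : I -> I -> 'F_2) (N' : J -> J -> 'F_2) :=
  exists L L', [/\ cancel L L', cancel L' L,
    forall u v, L (addf u v) = addf (L u) (L v) &
    forall u v, zp N u v <-> zp N' (L u) (L v)].

(** Composing a character with the inverse isomorphism gives a homomorphism, which is again some
    [chi] by [hom_chi]; primitives of products are transported in the same way. *)
Lemma grpiso_zpiso (I J : finType) (N : I -> I -> 'F_2) (N' : J -> J -> 'F_2) :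
  acyclic N -> acyclic N' -> grpiso N N' -> zpiso N N'.
Proof.
move=> acN acN' [f [g [fK gK fM]]].
have gM k l : g (gmul N' k l) = gmul N (g k) (g l).
  by apply: (can_inj fK); rewrite fM !gK.
have N0 i := acyclic_diag i acN; have N'0 j := acyclic_diag j acN'.
have Lg u k : chi (fun j => chi u (g (unit_at j 1))) k = chi u (g k).
  rewrite -(@hom_chi _ N' N'0 (fun k => chi u (g k))) // => k1 l1.
  by rewrite gM chi_gmul.
have Lf u k : chi (fun i => chi u (f (unit_at i 1))) k = chi u (f k).
  rewrite -(@hom_chi _ N N0 (fun k => chi u (f k))) // => k1 l1.
  by rewrite fM chi_gmul.
exists (fun u j => chi u (g (unit_at j 1))),
  (fun u i => chi u (f (unit_at i 1))).
split.
- by move=> u; apply/funext => i; rewrite Lg fK chi_unit mulr1.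
- by move=> u; apply/funext => j; rewrite Lf gK chi_unit mulr1.
- move=> u v; apply/funext => j; rewrite /addf /chi -big_split /=.
  by apply: eq_bigr => i _; rewrite mulrDl.
- move=> u v; split.
    move=> /(zp_cobounds acN)[h hM]; apply: (cobounds_zp acN').
    by exists (h \o g) => k l /=; rewrite gM hM !Lg.
  move=> /(zp_cobounds acN')[h hM]; apply: (cobounds_zp acN).
  by exists (h \o f) => k l /=; rewrite fM hM !Lg !fK.
Qed.

(* By comparison with the leading coordinates, nonzero classes with vanishing
   product differ by a column of N. *)
Lemma zp_lead (I : finType) (N : I -> I -> 'F_2) (r : I -> nat) u v :
  injective r -> (forall i j, N i j <> 0 -> (r i < r j)%N) ->
  zp N u v -> u <> @zerof I -> v <> @zerof I ->
  exists j, [/\ u j = 1, v j = 1, forall i, u i + v i = N i j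
                & forall i, (r j < r i)%N -> u i = 0].
Proof.
move=> r_inj Nr uv u0 v0.
have [i0 ui0] : exists i, u i != 0.
  apply: contrapT => h; apply: u0; apply/funext => i; apply: contrapT => ui.
  by apply: h; exists i; apply/eqP.
pose P i := (u i != 0) || (v i != 0).
have Pi0 : P i0 by rewrite /P ui0.
(* j is the last coordinate where u or v is nonzero. If only one of them were nonzero there, the
   equations at the pairs (i, j) would make the other vanish everywhere. *)
case: (arg_maxnP r Pi0) => j; rewrite /P => Pj jmax.
have N0 := acyclic_lt Nr.
have big i : (r j < r i)%N -> u i = 0 /\ v i = 0.
  move=> ji; have := jmax i; case: eqP => [-> | _] /=.
    by case: eqP => [-> //| _] /(_ isT); lia.
  by move=> /(_ isT); lia.
have nb i : i <> j -> ~ (r j < r i)%N -> (r i < r j)%N.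
  by move=> ij; have : r i <> r j by [move/r_inj]; lia.
have zpj i : i <> j -> (r i < r j)%N ->
    u i * v j + u j * v i = N i j * (u j * v j).
  by move=> /eqP ij rij; rewrite uv // (N0 i j) // mul0r addr0.
have vj : v j = 1.
  apply: F2_neq0 => vj; apply: v0; apply/funext => i; rewrite /zerof.
  have uj : u j = 1 by apply: F2_neq0 => uj; rewrite uj vj eqxx in Pj.
  have [-> // | /eqP ij] := eqVneq i j.
  case: (boolP (r j < r i)%N) => [/big[] //| /negP /(nb _ ij) rij].
  by have := zpj _ ij rij; rewrite uj vj !mulr0 add0r mul1r.
have uj : u j = 1.
  apply: F2_neq0 => uj; apply: u0; apply/funext => i; rewrite /zerof.
  have [-> // | /eqP ij] := eqVneq i j.
  case: (boolP (r j < r i)%N) => [/big[] //| /negP /(nb _ ij) rij].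
  by have := zpj _ ij rij; rewrite uj vj !mul0r mulr0 mulr1 addr0.
exists j; split => // i; last by move/big => [].
have [-> | /eqP ij] := eqVneq i j.
  rewrite uj vj F2D; apply/esym/F2_neq1 => /Nr; lia.
case: (boolP (r j < r i)%N) => [rji| /negP /(nb _ ij) rij].
  by have [-> ->] := big _ rji; rewrite addr0 (N0 _ _ rji).
by have := zpj _ ij rij; rewrite uj vj !mul1r !mulr1.
Qed.

(** * Sums of pairs with zero product, and zero divisors of degree one *)

Section Invariants.
Variables (I : finType) (N : I -> I -> 'F_2).
Implicit Types (a u v : I -> 'F_2).

Definition split_class a :=
  exists u v, [/\ u <> @zerof I, v <> @zerof I, zp N u v & a = addf u v].

Definition annihilated a := exists2 v, v <> @zerof I & zp N a v.

Lemma annihilated_inh a v i : v i <> 0 -> zp N a v -> annihilated a.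
Proof. by move=> vi av; exists v => // v0; apply: vi; rewrite v0. Qed.

Hypothesis acN : acyclic N.

(** This is the relation x_j^2 = x_j sum_i N_ij x_i of the cohomology ring. *)
Lemma zp_col j :
  zp N (fun i => (i == j)%:R) (fun i => (i == j)%:R + N i j).
Proof.
have Njj := acyclic_diag j acN.
move=> a b ab; case: (eqVneq a j) ab => [-> | aj] ab.
  rewrite eq_sym (negPf ab) Njj !(mul0r, mulr0, mul1r, add0r, addr0).
  by rewrite mulr1.
rewrite !(mul0r, mulr0, mul1r, add0r, addr0).
case: (eqVneq b j) ab => [-> | bj] ab; last first.
  by rewrite !(mul0r, mulr0, mul1r, add0r, addr0).
by rewrite Njj !(mul0r, mulr0, mul1r, mulr1, add0r, addr0).
Qed.

Lemma split_classP a : split_class a <-> exists j, a = N ^~ j.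
Proof.
split=> [[u [v [u0 v0 uv ->]]] | [j ->]].
  case: acN => r [r_inj Nr]; have [j [_ _ jP _]] := zp_lead r_inj Nr uv u0 v0.
  by exists j; apply/funext => i; rewrite /addf jP.
exists (fun i => (i == j)%:R), (fun i => (i == j)%:R + N i j); split.
- by move/(congr1 (fun h => h j)); rewrite eqxx => /eqP; rewrite oner_eq0.
- move/(congr1 (fun h => h j)); rewrite eqxx (acyclic_diag j acN) addr0.
  by move/eqP; rewrite oner_eq0.
- exact: zp_col.
- by apply/funext => i; rewrite /addf addrA F2D add0r.
Qed.

End Invariants.

Section ZpIso.
Variables (I J : finType) (N : I -> I -> 'F_2) (N' : J -> J -> 'F_2).
Variables (L : (I -> 'F_2) -> (J -> 'F_2)) (L' : (J -> 'F_2) -> (I -> 'F_2)).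
Hypotheses (LK : cancel L L')
  (LD : forall u v, L (addf u v) = addf (L u) (L v)).
Hypothesis Lzp : forall u v, zp N u v <-> zp N' (L u) (L v).

Lemma additive_zerof : L (@zerof I) = @zerof J.
Proof.
have -> : @zerof I = addf (@zerof I) (@zerof I).
  by apply/funext => i; rewrite /addf addr0.
by rewrite LD; apply/funext => j; rewrite /addf F2D.
Qed.

Lemma additive_neq0 u : u <> @zerof I -> L u <> @zerof J.
Proof. by rewrite -additive_zerof => u0 /(can_inj LK). Qed.

Lemma split_class_map a : split_class N a -> split_class N' (L a).
Proof.
move=> [u [v [u0 v0 uv ->]]]; exists (L u), (L v); split.
- exact: additive_neq0.
- exact: additive_neq0.
- by apply/Lzp.
- exact: LD.
Qed.

Lemma annihilated_map a : annihilated N a -> annihilated N' (L a).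
Proof.
by move=> [v v0 av]; exists (L v); [exact: additive_neq0|by apply/Lzp].
Qed.

End ZpIso.

Lemma zpiso_sym (I J : finType) (N : I -> I -> 'F_2) (N' : J -> J -> 'F_2) :
  zpiso N N' -> zpiso N' N.
Proof.
move=> [L [L' [LK L'K LD Lzp]]]; exists L', L; split => // u v.
  by apply: (can_inj LK); rewrite LD !L'K.
by rewrite Lzp !L'K.
Qed.

Lemma zpisoP (I J : finType) (N : I -> I -> 'F_2) (N' : J -> J -> 'F_2) :
  zpiso N N' ->
  exists L, [/\ bijective L, forall u v, L (addf u v) = addf (L u) (L v),
    forall a, split_class N a = split_class N' (L a) &
    forall a, annihilated N a = annihilated N' (L a)].
Proof.
move=> H; have [L [L' [LK L'K LD Lzp]]] := H.
have L'D u v : L' (addf u v) = addf (L' u) (L' v).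
  by apply: (can_inj LK); rewrite LD !L'K.
have L'zp u v : zp N' u v <-> zp N (L' u) (L' v) by rewrite Lzp !L'K.
exists L; split => //; first by exists L'.
- move=> a; apply/propext; split; first exact: (split_class_map LK).
  by move=> /(split_class_map L'K L'D L'zp); rewrite LK.
- move=> a; apply/propext; split; first exact: (annihilated_map LK).
  by move=> /(annihilated_map L'K L'D L'zp); rewrite LK.
Qed.

(* The solutions u of u^2 = a u in H^1(-; F_2) *)
Definition eigen (I : finType) (N : I -> I -> 'F_2) (a : I -> 'F_2) :=
  finset (fun u : {ffun I -> 'F_2} => `[< zp N u (addf u a) >]).

Lemma eigenP (I : finType) (N : I -> I -> 'F_2) a (u : {ffun I -> 'F_2}) :
  reflect (zp N u (addf u a)) (u \in eigen N a).
Proof. by rewrite /eigen finset.in_set; exact: asboolP. Qed.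

(** The class b stays existential because only the maximum of these cardinals over all classes is
    compared. *)
Lemma zpiso_eigen (I J : finType) (N : I -> I -> 'F_2) (N' : J -> J -> 'F_2) :
  zpiso N N' -> forall a, exists b, (#|eigen N a| <= #|eigen N' b|)%N.
Proof.
move=> [L [L' [LK L'K LD Lzp]]] a; exists (L a).
pose F (u : {ffun I -> 'F_2}) : {ffun J -> 'F_2} := finfun (L u).
have Finj : injective F.
  move=> u v /ffunP e; apply/ffunP => i.
  suff -> : (u : I -> 'F_2) = v by [].
  by apply: (can_inj LK); apply/funext => j; have := e j; rewrite !ffunE.
rewrite -(card_imset _ Finj); apply/subset_leq_card/fintype.subsetP => y.
move=> /imsetP[u /eigenP uv ->]; apply/eigenP.
have -> : (F u : J -> 'F_2) = L u by apply/funext => j; rewrite ffunE.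
by rewrite -LD; apply/Lzp.
Qed.

(** * Real Bott manifolds as quotients of R^n *)

Section Circle.
Variable R : realType.
Implicit Types (x y : R).

Lemma circle_expP x y :
  circle_exp x = circle_exp y <-> cos x = cos y /\ sin x = sin y.
Proof.
split; first by move=> /(congr1 val) /= [-> ->].
by move=> [c s]; apply: val_inj; rewrite /= c s.
Qed.

Lemma circle_exp_opp x : circle_opp (circle_exp x) = circle_exp (x + pi).
Proof. by apply: val_inj; rewrite /= cosDpi sinDpi. Qed.

Lemma circle_exp_conj x : circle_conj (circle_exp x) = circle_exp (- x).
Proof. by apply: val_inj; rewrite /= cosN sinN. Qed.

Lemma circle_exp_period x (m : int) :
  circle_exp (x + (2 * m)%:~R * pi) = circle_exp x.
Proof.
have pos (n : nat) (z : R) : circle_exp (z + (2 * n%:Z)%:~R * pi)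
  = circle_exp z.
  elim: n z => [|n IH] z; first by rewrite mulr0 mul0r addr0.
  have -> : z + (2 * n.+1%:Z)%:~R * pi = (z + (2 * n%:Z)%:~R * pi) + pi + pi.
    have -> : 2 * n.+1%:Z = 2 * n%:Z + 2 by lia.
    by rewrite intrD; move: (@pi R) => p; ring.
  by rewrite -!circle_exp_opp IH; apply: val_inj; rewrite /= opprK.
case: (intP m) => [|n|n]; [exact: (pos 0%N)|exact: pos|].
by rewrite -[in RHS](subrK ((2 * n.+1%:Z)%:~R * pi) x) pos mulrN intrN mulNr.
Qed.

Lemma cos_eq1 x : cos x = 1 -> exists m : int, x = (2 * m)%:~R * pi.
Proof.
move=> cx; have pi0 := pi_gt0 R.
(* The shift by pi rounds x / (2 pi) to a nearest integer, so the remainder lies in [-pi, pi], where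
   the cosine determines the absolute value. *)
pose m := Num.floor ((x + pi) / (2 * pi)).
have p20 : 0 < 2 * pi :> R by lra.
have /andP[m1 m2] := floor_itv ((x + pi) / (2 * pi)).
rewrite -/m in m1 m2.
rewrite ler_pdivlMr // in m1; rewrite ltr_pdivrMr // intrD in m2.
exists m; pose y := x - (2 * m)%:~R * pi.
have [cy _] : cos x = cos y /\ sin x = sin y.
  by apply/circle_expP; rewrite /y -mulNr -intrN -mulrN circle_exp_period.
have y1 : `|y| <= pi.
  by rewrite ler_norml /y intrM; apply/andP; split; lra.
suff : `|y| = 0 by move/normr0_eq0/eqP; rewrite /y subr_eq0 => /eqP.
apply: (@cos_inj R).
- by rewrite in_itv /= normr_ge0.
- by rewrite in_itv /= lexx ltW.
- by rewrite cos_norm -cy cx cos0.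
Qed.

Lemma circle_exp_eq x y :
  circle_exp x = circle_exp y -> exists m : int, y = x + (2 * m)%:~R * pi.
Proof.
move=> /circle_expP[c s].
have [m e] : exists m : int, y - x = (2 * m)%:~R * pi.
  by apply: cos_eq1; rewrite cosB c s -!expr2 cos2Dsin2.
by exists m; rewrite -e addrC subrK.
Qed.

Lemma circle_exp_surj (z : circle R) : exists x, z = circle_exp x.
Proof.
case: z => [[a b] z1]; have := z1; rewrite normc_def /= => /eqP [] e.
have {}e : a ^+ 2 + b ^+ 2 = 1.
  have := congr1 (fun t => t ^+ 2) e; rewrite sqr_sqrtr ?expr1n //.
  by rewrite addr_ge0 ?sqr_ge0.
have a1 : -1 <= a <= 1.
  rewrite -ler_norml -(@ler_pXn2r _ 2) ?nnegrE // real_normK ?num_real //.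
  by rewrite expr1n -e lerDl sqr_ge0.
have ca : cos (acos a) = a by rewrite acosK // in_itv.
have sa : sin (acos a) = `|b|.
  by rewrite sin_acos // -e addrAC subrr add0r sqrtr_sqr.
have [b0|b0] := leP 0 b.
  by exists (acos a); apply: val_inj; rewrite /= ca sa ger0_norm.
by exists (- acos a); apply: val_inj;
  rewrite /= cosN sinN ca sa ltr0_norm ?opprK.
Qed.

End Circle.

Section Action.
Variables (R : realType) (I : finType) (N : I -> I -> 'F_2).
Implicit Types (k l : I -> int) (x y : I -> R).

Definition act k x : I -> R :=
  fun i => (sgn2 (hol N k i))%:~R * x i + (k i)%:~R * pi.

Lemma act_gmul k l x : act (gmul N k l) x = act k (act l x).
Proof.
apply/funext => i; rewrite /act hol_gmul sgn2D /gmul intrD !intrM.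
by move: (@pi R) => p; ring.
Qed.

Lemma act1 x : act (@gone I) x = x.
Proof. by apply/funext => i; rewrite /act hol_gone mul1r mul0r addr0. Qed.

Lemma actK k : cancel (act k) (act (ginv N k)).
Proof. by move=> x; rewrite -act_gmul gmulVl act1. Qed.

Lemma actVK k : cancel (act (ginv N k)) (act k).
Proof. by move=> x; rewrite -act_gmul gmulV act1. Qed.

Lemma act0 k i : act k (fun=> 0) i = (k i)%:~R * pi.
Proof. by rewrite /act mulr0 add0r. Qed.

Lemma act_inj0 k l : act k (fun=> 0) = act l (fun=> 0) -> k = l.
Proof.
move=> e; apply/funext => i; have := congr1 (fun h => h i) e.
rewrite !act0 => /(mulIf (lt0r_neq0 (pi_gt0 R))) /eqP.
by rewrite eqr_int => /eqP.
Qed.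

Lemma sgn2_norm a (c : R) : `|(sgn2 a)%:~R * c| = `|c|.
Proof.
by case: (F2P a) => ->; rewrite ?mul1r // mulrNz mulNr mul1r normrN.
Qed.

Definition eclose (e : R) x y := forall i, `|x i - y i| < e.

Lemma act_dist k x y i : `|act k x i - act k y i| = `|x i - y i|.
Proof.
by rewrite -(sgn2_norm (hol N k i) (x i - y i)) /act; congr `|_|;
  move: (@pi R) => p; ring.
Qed.

Lemma act_eclose e k x y : eclose e x y -> eclose e (act k x) (act k y).
Proof. by move=> xy i; rewrite act_dist. Qed.

Lemma eclose_sym e x y : eclose e x y -> eclose e y x.
Proof. by move=> xy i; rewrite distrC. Qed.

Lemma eclose_trans d e y x z : eclose d x y -> eclose e y z ->
  eclose (d + e) x z.
Proof.
by move=> xy yz i; apply: le_lt_trans (ler_distD (y i) _ _) (ltrD _ _).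
Qed.

Lemma eclose_refl e x : 0 < e -> eclose e x x.
Proof. by move=> e0 i; rewrite subrr normr0. Qed.

Lemma eclose_le d e x y : d <= e -> eclose d x y -> eclose e x y.
Proof. by move=> de xy i; apply: lt_le_trans (xy i) de. Qed.

(** Induction on the rank: once k and l agree on the coordinates whose generators conjugate i, the
    signs at i agree, and the i-th coordinates of the two images differ by an integral multiple of
    pi. *)
Lemma act_sep k l x : acyclic N -> eclose pi (act k x) (act l x) -> k = l.
Proof.
move=> [r [_ Nr]] kl; apply/funext => i.
have [n] := ubnP (r i); elim: n i => // n IH i rin.
have e : hol N k i = hol N l i.
  apply: eq_bigr => j _; case: (F2P (N j i)) => [->|Nji];
    first by rewrite !mul0r.
  have : N j i <> 0 by rewrite Nji; exact: F2_1_neq0.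
  by move/Nr => rji; rewrite IH //; lia.
have := kl i; rewrite /act e.
have -> : (sgn2 (hol N l i))%:~R * x i + (k i)%:~R * pi -
  ((sgn2 (hol N l i))%:~R * x i + (l i)%:~R * pi) = (k i - l i)%:~R * pi.
  by rewrite intrB; move: (@pi R) => p; ring.
rewrite normrM (gtr0_norm (pi_gt0 R)) -ltr_pdivlMr ?pi_gt0 //.
by rewrite divff ?gt_eqF ?pi_gt0 // -intr_norm ltrz1; lia.
Qed.

End Action.

Section Orbits.
Variables (R : realType) (n : nat) (A : 'M['F_2]_n).

(** The matrix A - 1 of a Bott matrix; the guard makes it strictly triangular for every A. *)
Definition bottN (i j : 'I_n) : 'F_2 := if (i < j)%N then A i j else 0.

Lemma bottN_acyclic : acyclic bottN.
Proof.
exists (@nat_of_ord n); split; first exact: ord_inj.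
by move=> i j; rewrite /bottN; case: ifP.
Qed.

Definition torus_exp (x : 'I_n -> R) : torus R n :=
  [ffun j => circle_exp (x j)].

Let word (s : seq 'I_n) := foldr (fun i => gmul bottN (unit_at i 1))
  (@gone _) s.

Lemma bott_gen_exp i (x : 'I_n -> R) :
  bott_gen A i (torus_exp x) = torus_exp (act bottN (unit_at i 1) x).
Proof.
apply/ffunP => j; rewrite !ffunE /act hol_unit mulr1 /unit_at /bottN.
case: eqP => [-> | ij].
  by rewrite ltnn mul1r mul1r circle_exp_opp.
rewrite mul0r addr0; case: (i < j)%N => /=; last by rewrite mul1r.
case: (F2P (A i j)) => ->; first by rewrite mul1r.
by rewrite eqxx mulN1r circle_exp_conj.
Qed.

Lemma word_exp s (x : 'I_n -> R) :
  foldr (bott_gen A) (torus_exp x) s = torus_exp (act bottN (word s) x).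
Proof.
elim: s => [|i s IH] /=; first by rewrite act1.
by rewrite IH bott_gen_exp act_gmul.
Qed.

Lemma word_parity s i : (word s i)%:~R = (count_mem i s)%:R :> 'F_2.
Proof.
elim: s => [//|j s IH] /=; rewrite /gmul intrD intrM sgn2_F2 mul1r IH.
by rewrite natrD /unit_at eq_sym; case: eqP.
Qed.

Lemma hol_parity (I : finType) (N : I -> I -> 'F_2) k l :
  (forall i, (k i)%:~R = (l i)%:~R :> 'F_2) -> hol N k = hol N l.
Proof. by move=> kl; apply/funext => i; apply: eq_bigr => j _; rewrite kl. Qed.

Lemma F2_int_even (c : int) : c%:~R = 0 :> 'F_2 -> exists m, c = 2 * m.
Proof.
move=> c0; exists (c %/ 2)%Z; have := divz_eq c 2.
have := modz_ge0 c (isT : (2 : int) != 0).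
have := ltz_pmod c (isT : 0 < (2 : int)).
move: (c %/ 2)%Z (c %% 2)%Z => q m m2 m0 ce.
have [e|e] : m = 0 \/ m = 1 by lia.
  by rewrite ce e addr0 mulrC.
move: c0; rewrite ce e intrD intrM => /eqP.
by rewrite F2_two mulr0 add0r oner_eq0.
Qed.

(** A word in the g_i lifts to a product of units, and two lifts of a point of the torus differ by
    multiples of 2 pi. Adding even integers to k does not change its holonomy, so the fibres are the
    orbits of the deformed group. *)
Lemma real_bott_param_eq (x y : 'rV[R]_n) :
  real_bott_param A x = real_bott_param A y <->
  exists k, (y 0 : 'I_n -> R) = act bottN k (x 0).
Proof.
rewrite /real_bott_param; split.
  move=> /eqmodP /asboolP[s]; rewrite -/(torus_exp (x 0)) -/(torus_exp (y 0)).
  rewrite word_exp => e.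
  have h j : exists m : int,
      y 0 j = act bottN (word s) (x 0) j + (2 * m)%:~R * pi.
    by apply: circle_exp_eq; move/ffunP/(_ j): e; rewrite !ffunE.
  have [m hm] := choice h.
  exists (fun j => word s j + 2 * m j); apply/funext => j.
  rewrite hm /act [in RHS](@hol_parity _ _ _ (word s)) => [|i].
    by rewrite intrD; move: (@pi R) => p; ring.
  rewrite intrD intrM.
  by rewrite F2_two mul0r addr0.
move=> [k yk]; apply/eqmodP.
rewrite -/(torus_exp (x 0)) -/(torus_exp (y 0)) /= /bott_orbit_rel.
apply/asboolP.
(* Each generator with an odd entry in k occurs once; the word then has the parities of k, hence its
   holonomy. *)
pose s := [seq i <- enum 'I_n | (k i)%:~R != 0 :> 'F_2].
have ks i : (k i)%:~R = (word s i)%:~R :> 'F_2.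
  rewrite word_parity count_uniq_mem ?filter_uniq //; last first.
    by rewrite -enumT enum_uniq.
  by rewrite mem_filter mem_enum andbT; case: (F2P (k i)%:~R) => ->.
exists s; rewrite word_exp.
apply/ffunP => j; rewrite !ffunE yk /act (hol_parity _ ks).
have [|m hm] := @F2_int_even (k j - word s j).
  by rewrite intrB ks subrr.
rewrite -(circle_exp_period (_ + (word s j)%:~R * pi) m) -hm intrB.
by congr circle_exp; move: (@pi R) => p; ring.
Qed.

Lemma real_bott_param_surj (p : real_bott R A) :
  exists x, real_bott_param A x = p.
Proof.
have -> : p = \pi_({eq_quot (@bott_orbit_rel R n A)}) (repr p) by rewrite reprK.
move: (repr p) => z; have [x hx] := choice (fun j => circle_exp_surj (z j)).
exists (\row_j x j); rewrite /real_bott_param; congr (\pi_({eq_quot _}) _).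
by apply/ffunP => j; rewrite ffunE mxE.
Qed.

End Orbits.

(** * Lifting maps and diffeomorphisms *)

Section Lifting.
Variables (R : realType) (I J : finType) (X : Type).
Variable (q : (J -> R) -> X).
Hypothesis q_sep : forall y y', q y = q y' -> eclose pi y y' -> y = y'.
Implicit Types (x : I -> R) (y : J -> R).

Definition scalef (s : R) x : I -> R := fun i => s * x i.

Lemma scalef0 x : scalef 0 x = (fun=> 0).
Proof. by apply/funext => i; rewrite /scalef mul0r. Qed.

Lemma scalef1 x : scalef 1 x = x.
Proof. by apply/funext => i; rewrite /scalef mul1r. Qed.

Lemma eclose_scalef d (s : R) x x' :
  0 <= s <= 1 -> eclose d x x' -> eclose d (scalef s x) (scalef s x').
Proof.
move=> /andP[s0 s1] xx' i; rewrite /scalef -mulrBr normrM (ger0_norm s0).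
by apply: le_lt_trans (xx' i); rewrite ler_piMl.
Qed.

Lemma ray_step d x (m j : nat) : (0 < m)%N -> eclose (m%:R * d) x (fun=> 0) ->
  eclose d (scalef (j%:R / m%:R) x) (scalef (j.+1%:R / m%:R) x).
Proof.
move=> m0 xm i; rewrite distrC /scalef -mulrBl -mulrBl -natrB // subSnn mul1r.
have m0' : 0 < m%:R :> R by rewrite ltr0n.
rewrite normrM ger0_norm ?invr_ge0 ?ltW // mulrC ltr_pdivrMr // mulrC.
by have := xm i; rewrite subr0.
Qed.

Lemma ray_bound d x : 0 < d ->
  exists m : nat, (0 < m)%N /\ eclose (m%:R * d) x (fun=> 0).
Proof.
move=> d0; exists (Num.truncn ((\sum_i `|x i|) / d)).+1; split => // i.
rewrite subr0 -ltr_pdivrMr //; apply: le_lt_trans (truncnS_gt _).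
rewrite ler_pM2r ?invr_gt0 // (bigD1 i) //= lerDl.
by apply: sumr_ge0.
Qed.

Lemma ratio_itv (j m : nat) : (j <= m)%N -> (0 < m)%N ->
  0 <= (j%:R / m%:R : R) <= 1.
Proof.
move=> jm m0; rewrite divr_ge0 ?ler0n //=.
by rewrite ler_pdivrMr ?ltr0n // mul1r ler_nat.
Qed.

Definition ray_close d e (F : (I -> R) -> (J -> R)) x :=
  forall s s', 0 <= s <= 1 -> 0 <= s' <= 1 ->
    eclose d (scalef s x) (scalef s' x) ->
      eclose e (F (scalef s x)) (F (scalef s' x)).

(** Where F and G agree at one point of a fine subdivision of the ray, at the next point both are
    within pi / 2 of the common value and lie in one fibre, hence coincide. Assuming closeness along
    a single ray lets the lemma compare lifts built with different numbers of steps. *)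
Lemma lift_unique_ray d (F G : (I -> R) -> (J -> R)) x : 0 < d ->
  F (fun=> 0) = G (fun=> 0) ->
  (forall s, 0 <= s <= 1 -> q (F (scalef s x)) = q (G (scalef s x))) ->
  ray_close d (pi / 2) F x -> ray_close d (pi / 2) G x -> F x = G x.
Proof.
move=> d0 FG0 qFG Fd Gd.
have [m [m0 xm]] := ray_bound x d0.
suff H j : (j <= m)%N ->
  F (scalef (j%:R / m%:R) x) = G (scalef (j%:R / m%:R) x).
  by have := H m (leqnn _); rewrite divff ?pnatr_eq0 -?lt0n // scalef1.
elim: j => [_|j IH jm]; first by rewrite mul0r scalef0.
apply: q_sep; first by apply: qFG; exact: ratio_itv.
have st := ray_step j m0 xm.
have rj := ratio_itv (ltnW jm) m0; have rj1 := ratio_itv jm m0.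
have h1 := Fd _ _ rj rj1 st; have h2 := Gd _ _ rj rj1 st.
rewrite IH 1?ltnW // in h1.
by have := eclose_trans (eclose_sym h1) h2; apply: eclose_le; lra.
Qed.

Definition ucont (F : (I -> R) -> (J -> R)) :=
  forall e, 0 < e -> exists2 d, 0 < d & forall x x', eclose d x x' ->
    eclose e (F x) (F x').

Lemma lift_unique (F G : (I -> R) -> (J -> R)) : ucont F -> ucont G ->
  (forall x, q (F x) = q (G x)) -> F (fun=> 0) = G (fun=> 0) -> F = G.
Proof.
move=> Fc Gc qFG FG0; have p2 : 0 < pi / 2 :> R by rewrite divr_gt0 ?pi_gt0.
have [d d0 Fd] := Fc _ p2; have [d' d0' Gd] := Gc _ p2.
have m0 : 0 < Num.min d d' by rewrite lt_min d0.
apply/funext => x; apply: (lift_unique_ray m0) => //.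
- by move=> s s' _ _ ss; apply: Fd; apply: eclose_le ss; rewrite ge_min lexx.
- by move=> s s' _ _ ss; apply: Gd; apply: eclose_le ss;
  rewrite ge_min lexx orbT.
Qed.

Variables (h : (I -> R) -> X) (y0 : J -> R).
Hypothesis q_y0 : q y0 = h (fun=> 0).
Hypothesis h_unif : forall e, 0 < e -> exists2 d, 0 < d & forall x x' y,
  eclose d x x' -> q y = h x -> exists2 y', q y' = h x' & eclose e y y'.

(* The value at x is obtained by lifting h along the ray from 0 to x in finitely
   many small steps, each time choosing the point of the fibre close to the
   previous one; the result does not depend on the number of steps. *)
Lemma lift_exists : exists F, [/\ F (fun=> 0) = y0, forall x, q (F x) = h x &
  ucont F].
Proof.
have pi0 := pi_gt0 R.
(* In [YY] four distances below pi / 4 are chained; their sum must stay below the separation pi of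
   the fibres. *)
have p4 : 0 < pi / 4 :> R by lra.
have [d d0 hd] := h_unif p4.
have stepP (t : (J -> R) * (I -> R)) : exists y' : J -> R,
    (exists2 x, q t.1 = h x & eclose d x t.2) ->
    q y' = h t.2 /\ eclose (pi / 4) t.1 y'.
  case: t => y x' /=.
  have [[x yx xx']|nex] := pselect (exists2 x, q y = h x & eclose d x x').
    by have [y' ? ?] := hd _ _ _ xx' yx; exists y'.
  (* A default value: once the steps are short enough, only pairs of the first kind are reached. *)
  by exists y0 => /nex.
have [nx nxP] := choice stepP.
pose p m x j := scalef (j%:R / m%:R) x.
pose Y m x j := iteri j (fun i y => nx (y, p m x i.+1)) y0.
have YS m x j : Y m x j.+1 = nx (Y m x j, p m x j.+1) by [].
have Yq m x j : (0 < m)%N -> eclose (m%:R * d) x (fun=> 0) ->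
  q (Y m x j) = h (p m x j).
  move=> m0 xm; elim: j => [|j IH]; first by rewrite /p mul0r scalef0.
  rewrite YS; apply: (nxP (_, _) _).1; exists (p m x j) => //=.
  exact: ray_step.
have Yc m x j : (0 < m)%N -> eclose (m%:R * d) x (fun=> 0) ->
    eclose (pi / 4) (Y m x j) (Y m x j.+1).
  move=> m0 xm; rewrite YS; apply: (nxP (_, _) _).2; exists (p m x j) => /=.
    exact: Yq.
  exact: ray_step.
have YY m x x' j : (0 < m)%N -> eclose (m%:R * d) x (fun=> 0) ->
    eclose (m%:R * d) x' (fun=> 0) -> eclose d x x' -> (j <= m)%N ->
    eclose (pi / 4) (Y m x j) (Y m x' j).
  move=> m0 xm xm' xx'; elim: j => [|j IH] jm; first exact: eclose_refl.
  have pp := eclose_scalef (ratio_itv jm m0) xx'.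
  have [z zq zc] := hd _ _ _ pp (Yq _ _ _ m0 xm).
  suff <- : z = Y m x' j.+1 by [].
  apply: q_sep; first by rewrite zq Yq.
  have := eclose_trans (eclose_sym zc)
    (eclose_trans (eclose_sym (Yc m x j m0 xm))
    (eclose_trans (IH (ltnW jm)) (Yc m x' j m0 xm'))).
  by apply: eclose_le; lra.
pose Fm m x := Y m x m.
have pm m x : (0 < m)%N -> p m x m = x.
  by move=> m0; rewrite /p divff ?scalef1 // pnatr_eq0 -lt0n.
have Fmq m x : (0 < m)%N -> eclose (m%:R * d) x (fun=> 0) -> q (Fm m x) = h x.
  by move=> m0 xm; rewrite Yq // pm.
have z0 m : (0 < m)%N -> eclose (m%:R * d) (fun=> 0 : R) (fun=> 0 : R) (I := I).
  by move=> m0; apply: eclose_refl; rewrite mulr_gt0 ?ltr0n.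
have zs m x s : 0 <= s <= 1 -> eclose (m%:R * d) x (fun=> 0) ->
    eclose (m%:R * d) (scalef s x) (fun=> 0).
  move=> s01 xm; have := eclose_scalef s01 xm.
  by congr (eclose _ _ _); apply/funext => i; rewrite /scalef mulr0.
have Fm0 m : (0 < m)%N -> Fm m (fun=> 0) = y0.
  move=> m0; rewrite /Fm.
  suff H j : Y m (fun=> 0) j = y0 by [].
  elim: j => // j IH; apply: esym; apply: q_sep.
    rewrite q_y0 (Yq _ _ _ m0 (z0 m m0)); congr h.
    by apply/funext => i; rewrite /p /scalef mulr0.
  by have := Yc m (fun=> 0) j m0 (z0 m m0); rewrite IH; apply: eclose_le; lra.
have Fmm m m' x : (0 < m)%N -> (0 < m')%N -> eclose (m%:R * d) x (fun=> 0) ->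
    eclose (m'%:R * d) x (fun=> 0) -> Fm m x = Fm m' x.
  move=> m0 m0' xm xm'; apply: (lift_unique_ray d0); rewrite ?Fm0 //.
  - by move=> s s01; rewrite !Fmq //; exact: zs.
  - move=> s s' ss ss' c; apply: (@eclose_le _ _ (pi / 4)); first by lra.
    by apply: YY => //; exact: zs.
  - move=> s s' ss ss' c; apply: (@eclose_le _ _ (pi / 4)); first by lra.
    by apply: YY => //; exact: zs.
have [mm mmP] := choice (fun x => ray_bound x d0).
pose F x := Fm (mm x) x.
have Fq x : q (F x) = h x by have [? ?] := mmP x; exact: Fmq.
have Fc x x' : eclose d x x' -> eclose (pi / 4) (F x) (F x').
  move=> xx'; have [m0 xm] := mmP x; have [m0' xm'] := mmP x'.
  pose M := maxn (mm x) (mm x').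
  have M0 : (0 < M)%N by rewrite /M; lia.
  have Mx : eclose (M%:R * d) x (fun=> 0).
    by apply: eclose_le xm; rewrite ler_pM2r // ler_nat /M; lia.
  have Mx' : eclose (M%:R * d) x' (fun=> 0).
    by apply: eclose_le xm'; rewrite ler_pM2r // ler_nat /M; lia.
  by rewrite /F (Fmm _ M) // (Fmm (mm x') M) //; exact: YY.
exists F; split => //; first by rewrite /F Fm0 //; have [] := mmP (fun=> 0).
move=> e e0; have me : 0 < Num.min e (pi / 4) by rewrite lt_min e0.
have [d' d0' hd'] := h_unif me.
exists (Num.min d d'); first by rewrite lt_min d0.
move=> x x' xx'.
have c1 : eclose d x x' by apply: eclose_le xx'; rewrite ge_min lexx.
have c2 : eclose d' x x' by apply: eclose_le xx'; rewrite ge_min lexx orbT.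
have [y' yq yc] := hd' _ _ _ c2 (Fq x).
suff <- : y' = F x' by apply: eclose_le yc; rewrite ge_min lexx.
apply: q_sep; first by rewrite yq Fq.
apply: eclose_le (eclose_trans (eclose_sym yc) (Fc _ _ c1)).
have : Num.min e (pi / 4) <= pi / 4 by rewrite ge_min lexx orbT.
by lra.
Qed.

End Lifting.

(** * From diffeomorphisms to isomorphisms of deck groups *)

Section DiffeoGroup.
Variables (R : realType) (n : nat).
Implicit Types (A B : 'M['F_2]_n) (x y : 'I_n -> R).

Definition rowf x : 'rV[R]_n := \row_j x j.

Lemma rowfK x : (rowf x) 0 = x.
Proof. by apply/funext => j; rewrite mxE. Qed.

Lemma rowf_row (w : 'rV[R]_n) : rowf (w 0) = w.
Proof. by apply/rowP => j; rewrite mxE. Qed.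

Definition bott_param A x : real_bott R A := real_bott_param A (rowf x).

Lemma bott_param_eq A x y :
  bott_param A x = bott_param A y <-> exists k, y = act (bottN A) k x.
Proof. by rewrite /bott_param real_bott_param_eq !rowfK. Qed.

Lemma bott_param_surj A p : exists x, bott_param A x = p.
Proof.
have [w <-] := real_bott_param_surj p.
by exists (w 0); rewrite /bott_param rowf_row.
Qed.

Lemma bott_param_act A k x : bott_param A (act (bottN A) k x) = bott_param A x.
Proof. by apply/esym/bott_param_eq; exists k. Qed.

Lemma bott_param_sep A x y :
  bott_param A x = bott_param A y -> eclose pi x y -> x = y.
Proof.
move=> /bott_param_eq[k ->]; rewrite -{1 3}[x](act1 (bottN A)).
by move=> /act_sep <- //; exact: bottN_acyclic.
Qed.

Lemma ball_rowf (u : 'rV[R]_n) e x : 0 < e -> eclose e (u 0) x ->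
  ball u e (rowf x).
Proof. by move=> e0 ux; split=> // i j; rewrite ord1 mxE; exact: ux. Qed.

(** The chart expression F is a continuous lift near some point u over the image of x0. One deck
    transformation k carries x0 to u, another one l carries the value of F to the prescribed y; both
    are isometries, so the estimate survives. *)
Lemma smooth_map_local A B (f : real_bott R A -> real_bott R B) x0 e :
  smooth_map f -> 0 < e ->
  exists2 d, 0 < d & forall x x' y, eclose d x0 x -> eclose d x0 x' ->
    bott_param B y = f (bott_param A x) ->
    exists2 y', bott_param B y' = f (bott_param A x') & eclose e y y'.
Proof.
move=> fs e0; have [U [V [F [[Uo _] _ [u Uu up] Fs fF]]]] :=
  fs (bott_param A x0).
have [k uk] : exists k, u 0 = act (bottN A) k x0.
  by apply/bott_param_eq; rewrite /bott_param rowf_row.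
have Fu : {for u, continuous F} by exact: (Fs 0%N).
have e20 : 0 < e / 2 by rewrite divr_gt0.
have : nbhs u (U `&` F @^-1` (ball (F u) (e / 2)))%classic.
  apply: filterI; first exact: open_nbhs_nbhs.
  by apply: Fu; apply: nbhsx_ballx.
move=> /nbhs_ballP[d d0 dP]; exists d => // x x' y xd xd' yx.
have key z : eclose d x0 z -> exists2 w : 'rV[R]_n,
    bott_param B (w 0) = f (bott_param A z) & eclose (e / 2) (F u 0) (w 0).
  move=> zd; have [Uz Fz] : (U `&` F @^-1` ball (F u) (e / 2))%classic
    (rowf (act (bottN A) k z)).
    by apply: dP; apply: ball_rowf => //; rewrite uk; exact: act_eclose.
  exists (F (rowf (act (bottN A) k z))).
    have [_] := fF _ Uz; rewrite /bott_param rowf_row => ->.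
    by rewrite -/(bott_param A _) bott_param_act.
  by move=> j; have [_ /(_ 0 j)] := Fz.
have [w wq wc] := key _ xd; have [w' wq' wc'] := key _ xd'.
have [l yl] : exists l, y = act (bottN B) l (w 0).
  by apply/bott_param_eq; rewrite wq.
exists (act (bottN B) l (w' 0)); first by rewrite bott_param_act.
rewrite yl; apply: act_eclose; have := eclose_trans (eclose_sym wc) wc'.
by rewrite -splitr.
Qed.

(** The cube [0, 2 pi]^n is compact and meets every orbit, since even vectors act as translations by
    multiples of 2 pi. A bound d common to all its points is valid everywhere because the group acts
    by isometries. *)
Lemma smooth_map_unif A B (f : real_bott R A -> real_bott R B) e :
  smooth_map f -> 0 < e ->
  exists2 d, 0 < d & forall x x' y, eclose d x x' ->
    bott_param B y = f (bott_param A x) ->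
    exists2 y', bott_param B y' = f (bott_param A x') & eclose e y y'.
Proof.
move=> fs e0; have pi0 := pi_gt0 R.
pose P (d : R) (w : 'rV[R]_n) := forall x' y, eclose d (w 0) x' ->
    bott_param B y = f (bott_param A (w 0)) ->
    exists2 y', bott_param B y' = f (bott_param A x') & eclose e y y'.
pose K := [set w : 'rV[R]_n | forall j,
  `[0, 2 * pi]%classic (w ord0 j)]%classic.
have Kc : compact K.
  by apply: (@rV_compact R n (fun=> `[0, 2 * pi]%classic)) => _;
    exact: segment_compact.
have Kcov : \forall d \near at_right (0 : R), (K `<=` P d)%classic.
  move/compact_near_coveringP: Kc; apply => w _.
  have [d d0 dP] := smooth_map_local (w 0) fs e0.
  have d20 : 0 < d / 2 by rewrite divr_gt0.
  exists (ball w (d / 2), [set d' | d' < d / 2])%classic => /=.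
    split; first exact: nbhsx_ballx.
    exact: nbhs_right_lt.
  move=> [w' d'] /= [ww' dd'] x' y wx' yw.
  have c1 : eclose (d / 2) (w 0) (w' 0) by move=> j; have [_ /(_ 0 j)] := ww'.
  apply: (dP (w' 0)) => //; first by apply: eclose_le c1; lra.
  by apply: eclose_le (eclose_trans c1 wx'); lra.
have [d [d0 dK]] : exists d, 0 < d /\ (K `<=` P d)%classic.
  by have [d [? ?]] := filter_ex (filterI (nbhs_right_gt (0 : R)) Kcov);
    exists d.
exists d => // x x' y xx' yx.
pose m j : int := - (2 * Num.floor (x j / (2 * pi))).
have even j : (m j)%:~R = 0 :> 'F_2.
  rewrite /m intrN intrM.
  by rewrite F2_two mul0r oppr0.
have hm j : hol (bottN A) m j = 0.
  by rewrite /hol big1 // => i _; rewrite even mulr0.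
have mE z j : act (bottN A) m z j = z j - (2 * Num.floor (x j / (2 * pi)))%:~R *
  pi.
  by rewrite /act hm mul1r /m intrN mulNr.
have Kx : K (rowf (act (bottN A) m x)).
  move=> j /=; rewrite rowfK mE in_itv /= intrM.
  have p20 : 0 < 2 * pi :> R by lra.
  have /andP[] := floor_itv (x j / (2 * pi)).
  rewrite ler_pdivlMr // ltr_pdivrMr // intrD => h1 h2.
  by apply/andP; split; lra.
have [] := dK _ Kx (act (bottN A) m x') y.
- by rewrite rowfK; exact: act_eclose.
- by rewrite rowfK bott_param_act.
- by move=> y'; rewrite bott_param_act => ? ?; exists y'.
Qed.

Lemma smooth_map_lift A B (f : real_bott R A -> real_bott R B) :
  smooth_map f ->
  exists F, (forall x, bott_param B (F x) = f (bott_param A x)) /\ ucont F.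
Proof.
move=> fs; have [y0 y0q] := bott_param_surj (f (bott_param A (fun=> 0))).
have [e e0|F [_ Fq Fc]] := @lift_exists R _ _ _ _ (@bott_param_sep B)
  (fun x : 'I_n -> R => f (bott_param A x)) _ y0q.
  exact: smooth_map_unif.
by exists F.
Qed.

Lemma ucont_act (I J : finType) (N : J -> J -> 'F_2) k (F : (I -> R) ->
  (J -> R)) :
  ucont F -> ucont (act N k \o F).
Proof.
move=> Fc e e0; have [d d0 dP] := Fc e e0; exists d => // x x' xx' /=.
by apply: act_eclose; exact: dP.
Qed.

Lemma act_ucont (I J : finType) (N : I -> I -> 'F_2) k (F : (I -> R) ->
  (J -> R)) :
  ucont F -> ucont (F \o act N k).
Proof.
move=> Fc e e0; have [d d0 dP] := Fc e e0; exists d => // x x' xx' /=.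
by apply: dP; exact: act_eclose.
Qed.

Lemma ucont_comp (I J K : finType) (F : (I -> R) -> (J -> R))
  (G : (J -> R) -> (K -> R)) : ucont F -> ucont G -> ucont (G \o F).
Proof.
move=> Fc Gc e e0; have [d d0 dP] := Gc e e0; have [d' d0' dP'] := Fc d d0.
by exists d' => // x x' xx' /=; apply: dP; exact: dP'.
Qed.

Lemma ucont_id (I : finType) : ucont (fun x : I -> R => x).
Proof. by move=> e e0; exists e. Qed.

(** Some translate of G agrees with F at the origin; both lift the same map, so they are equal. *)
Lemma lift_deck (I : finType) B (F G : (I -> R) -> ('I_n -> R)) :
  ucont F -> ucont G ->
    (forall x : I -> R, bott_param B (F x) = bott_param B (G x)) ->
  exists k, forall x : I -> R, F x = act (bottN B) k (G x).
Proof.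
move=> Fc Gc FG; have /bott_param_eq[k ek] := esym (FG (fun=> 0)).
exists k => x; suff -> : F = act (bottN B) k \o G by [].
apply: (lift_unique (@bott_param_sep B)) => //; first exact: ucont_act.
by move=> z /=; rewrite FG bott_param_act.
Qed.

(** The lift F satisfies F(k x) = phi(k) F(x) for a unique phi(k). The lifts of f and of its inverse
    were chosen independently and are inverse to each other only up to deck transformations, which
    accounts for a conjugation in the inverse of phi. *)
Lemma diffeo_grpiso A B : diffeomorphic R A B -> grpiso (bottN A) (bottN B).
Proof.
move=> [f [g [fK gK fs gs]]].
have [F [Fq Fc]] := smooth_map_lift fs; have [G [Gq Gc]] := smooth_map_lift gs.
have [k0 GF] : exists k, forall x, G (F x) = act (bottN A) k x.
  apply: (lift_deck (F := G \o F) (G := id)) => //; first exact: ucont_comp.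
    exact: ucont_id.
  by move=> x /=; rewrite Gq Fq fK.
have [k1 FG] : exists k, forall x, F (G x) = act (bottN B) k x.
  apply: (lift_deck (F := F \o G) (G := id)) => //; first exact: ucont_comp.
    exact: ucont_id.
  by move=> x /=; rewrite Fq Gq gK.
have /choice[phi phiP] : forall k, exists k', forall x,
    F (act (bottN A) k x) = act (bottN B) k' (F x).
  move=> k; apply: (lift_deck (F := F \o act (bottN A) k)) => //.
    exact: act_ucont.
  by move=> x /=; rewrite !Fq bott_param_act.
have /choice[psi psiP] : forall k, exists k', forall x,
    G (act (bottN B) k x) = act (bottN A) k' (G x).
  move=> k; apply: (lift_deck (F := G \o act (bottN B) k)) => //.
    exact: act_ucont.
  by move=> x /=; rewrite !Gq bott_param_act.
have sep C k l (x : 'I_n -> R) : act (bottN C) k x = act (bottN C) l x -> k = l.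
  move=> e; apply: (@act_sep R _ _ k l x (bottN_acyclic C)); rewrite e.
  by apply: eclose_refl; exact: pi_gt0.
have phiM k l : phi (gmul (bottN A) k l) = gmul (bottN B) (phi k) (phi l).
  apply: (sep B _ _ (F (fun=> 0))).
  by rewrite -phiP !act_gmul !phiP.
(* From G F = k0 one gets k0 k = psi(phi(k)) k0, so the inverse of phi is psi conjugated by k0. *)
pose c k := gmul (bottN A) (ginv (bottN A) k0) (gmul (bottN A) (psi k) k0).
have phiK : cancel phi c.
  move=> k; apply: (sep A _ _ (fun=> 0)).
  by rewrite /c !act_gmul -GF -psiP -phiP GF actK.
have cK : cancel c phi.
  move=> k.
  have [x0 x0E] : exists x, F x = fun=> 0.
    by exists (G (act (bottN B) (ginv (bottN B) k1) (fun=> 0)));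
      rewrite FG actVK.
  apply: (sep B _ _ (F x0)).
  rewrite -phiP /c !act_gmul -GF -psiP.
  have Ginj : injective G.
    by move=> x y /(congr1 F); rewrite !FG => /(can_inj (actK _ _)).
  apply: Ginj.
  by rewrite GF actVK.
by exists phi, c.
Qed.

End DiffeoGroup.

(** * Affine equivalences *)

Section AffineMaps.
Variable R : realType.

Definition afffun (I : finType) (f : (I -> R) -> R) :=
  exists m c, forall x, f x = \sum_i m i * x i + c.

Definition affmap (I J : finType) (T : (I -> R) -> (J -> R)) :=
  forall j, afffun (fun x => T x j).

Section Closure.
Variable I : finType.
Implicit Types f g : (I -> R) -> R.

Lemma afffun_coord i : afffun (fun x : I -> R => x i).
Proof.
exists (fun j => (j == i)%:R), 0 => x; rewrite addr0 (bigD1 i) //= eqxx mul1r.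
by rewrite big1 ?addr0 // => j /negPf ->; rewrite mul0r.
Qed.

Lemma afffun_cst c : afffun (fun _ : I -> R => c).
Proof.
by exists (fun=> 0), c => x; rewrite big1 ?add0r // => i _; rewrite mul0r.
Qed.

Lemma afffunD f g : afffun f -> afffun g -> afffun (fun x => f x + g x).
Proof.
move=> [m [c fE]] [m' [c' gE]]; exists (fun i => m i + m' i), (c + c') => x.
rewrite fE gE addrACA -big_split /=; congr (_ + _).
by apply: eq_bigr => i _; rewrite mulrDl.
Qed.

Lemma afffunZ a f : afffun f -> afffun (fun x => a * f x).
Proof.
move=> [m [c fE]]; exists (fun i => a * m i), (a * c) => x.
rewrite fE mulrDr mulr_sumr; congr (_ + _).
by apply: eq_bigr => i _; rewrite mulrA.
Qed.

Lemma afffun_sum (J : finType) (f : J -> (I -> R) -> R) :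
  (forall j, afffun (f j)) -> afffun (fun x => \sum_j f j x).
Proof.
move=> fa; suff H (s : seq J) : afffun (fun x => \sum_(j <- s) f j x).
  by have := H (index_enum J).
elim: s => [|j s IH].
  have [m [c cE]] := afffun_cst 0; exists m, c => x; rewrite big_nil.
  exact: cE.
have [m [c cE]] := afffunD (fa j) IH; exists m, c => x; rewrite big_cons.
exact: cE.
Qed.

End Closure.

Lemma affmap_comp (I J K : finType) (T : (I -> R) -> (J -> R))
  (S : (J -> R) -> (K -> R)) : affmap T -> affmap S -> affmap (S \o T).
Proof.
move=> Ta Sa k; have [m [c mc]] := Sa k.
have [m' [c' mc']] : afffun (fun x => \sum_j m j * T x j + c).
  by apply: afffunD (afffun_cst _ _); apply: afffun_sum => j; exact: afffunZ.
by exists m', c' => x /=; rewrite mc mc'.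
Qed.

Lemma Ck_on_cst (V W : normedModType R) k (U : set V) (c : W) :
  Ck_on k U (fun=> c).
Proof.
elim: k c => [|k IH] c /=; first by move=> x _; exact: cst_continuous.
split=> [x _|v]; first exact: differentiable_cst.
have -> : 'D_v (fun=> c) = (fun=> 0 : W) by apply/funext => x;
  exact: derive_cst.
exact: IH.
Qed.

(** The derivative in the direction v is the constant value at v of the linear part, so all higher
    derivatives are those of a constant. *)
Lemma affmap_smooth (n : nat) (T : ('I_n -> R) -> ('I_n -> R))
  (U : set 'rV[R]_n) :
  affmap T -> smooth_on U (fun w => rowf (T (w 0))).
Proof.
move=> /choice[M /choice[c Tc]] k.
pose L (w : 'rV[R]_n) : 'rV[R]_n := \sum_i w 0 i *: \row_j M j i.
have FE (w : 'rV[R]_n) : rowf (T (w 0)) = L w + \row_j c j.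
  by apply/rowP => j; rewrite !mxE Tc /L summxE; congr (_ + _);
    apply: eq_bigr => i _; rewrite !mxE mulrC.
have -> : (fun w : 'rV[R]_n => rowf (T (w 0))) = (fun w => L w + \row_j c j).
  by apply/funext.
have Ldiff w : differentiable (fun w => L w + \row_j c j) w.
  apply: differentiableD; last exact: differentiable_cst.
  have -> : L = \sum_(i < n) (fun w : 'rV[R]_n => w 0 i *: \row_j M j i).
    by apply/funext => z; rewrite /L fct_sumE.
  apply: differentiable_sum => i; apply: differentiableZl.
  exact: differentiable_coord.
case: k => [|k] /=; first by move=> w _; exact: differentiable_continuous.
split=> [w _|v]; first exact: Ldiff.
have -> : 'D_v (fun w => L w + \row_j c j) = (fun=> L v).
  apply/funext => w; rewrite /derive; apply/cvg_lim => //.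
  apply: cvg_near_cst; near=> h => /=.
  have h0 : h != 0 by near: h; exact: nbhs_dnbhs_neq.
  have LD a u z : L (a *: u + z) = a *: L u + L z.
    rewrite /L scaler_sumr -big_split /=; apply: eq_bigr => i _.
    by rewrite !mxE scalerDl scalerA.
  by rewrite /shift /= LD opprD addrACA subrr addr0 addrK scalerA mulVf
    ?scale1r.
exact: Ck_on_cst.
Unshelve. all: by end_near.
Qed.

(** One relation serves both directions: such a pair of maps descends to a diffeomorphism of the
    quotients and conjugates one group into the other. The index types may differ. *)
Definition affequiv (I J : finType) (N : I -> I -> 'F_2)
  (N' : J -> J -> 'F_2) :=
  exists (T : (I -> R) -> (J -> R)) (S : (J -> R) -> (I -> R)) phi psi,
    [/\ affmap T /\ affmap S, cancel T S, cancel S T,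
        forall k x, T (act N k x) = act N' (phi k) (T x) &
        forall k y, S (act N' k y) = act N (psi k) (S y)].

Lemma affequiv_sym (I J : finType) (N : I -> I -> 'F_2) (N' : J -> J -> 'F_2) :
  affequiv N N' -> affequiv N' N.
Proof.
by move=> [T [S [phi [psi [[Ta Sa] TK SK Tk Sk]]]]]; exists S, T, psi, phi.
Qed.

Lemma affequiv_trans (I J K : finType) (N : I -> I -> 'F_2)
  (N' : J -> J -> 'F_2)
  (N'' : K -> K -> 'F_2) : affequiv N N' -> affequiv N' N'' -> affequiv N N''.
Proof.
move=> [T [S [phi [psi [[Ta Sa] TK SK Tk Sk]]]]].
move=> [T' [S' [phi' [psi' [[Ta' Sa'] TK' SK' Tk' Sk']]]]].
exists (T' \o T), (S \o S'), (phi' \o phi), (psi \o psi'); split.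
- by split; exact: affmap_comp.
- exact: can_comp.
- exact: can_comp.
- by move=> k x /=; rewrite Tk Tk'.
- by move=> k x /=; rewrite Sk' Sk.
Qed.

Lemma affequiv_grpiso (I J : finType) (N : I -> I -> 'F_2)
  (N' : J -> J -> 'F_2) :
  affequiv N N' -> grpiso N N'.
Proof.
move=> [T [S [phi [psi [_ TK SK Tk Sk]]]]].
have phiP k y : act N' (phi k) y = T (act N k (S y)) by rewrite Tk SK.
have psiP k x : act N (psi k) x = S (act N' k (T x)) by rewrite Sk TK.
exists phi, psi; split => [k|k|k l].
- by apply: (@act_inj0 R _ N); rewrite psiP phiP !TK.
- by apply: (@act_inj0 R _ N'); rewrite phiP psiP !SK.
- by apply: (@act_inj0 R _ N'); rewrite act_gmul !phiP TK act_gmul.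
Qed.

(** Points of a ball of radius pi / 2 are less than pi apart, so the projection is injective on it
    and such balls serve as chart domains; the source is cut down to the preimage of the target
    ball. *)
Lemma affequiv_diffeo (n : nat) (A B : 'M['F_2]_n) :
  affequiv (bottN A) (bottN B) -> diffeomorphic R A B.
Proof.
move=> [T [S [phi [psi [[Ta Sa] TK SK Tk Sk]]]]].
have [a aP] := choice (bott_param_surj (R := R) (A := A)).
have [b bP] := choice (bott_param_surj (R := R) (A := B)).
pose f p := bott_param B (T (a p)); pose g p := bott_param A (S (b p)).
have fE x : f (bott_param A x) = bott_param B (T x).
  rewrite /f; have /bott_param_eq[k ->] :
    bott_param A x = bott_param A (a (bott_param A x)).
    by rewrite aP.
  by rewrite Tk bott_param_act.
have gE y : g (bott_param B y) = bott_param A (S y).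
  rewrite /g; have /bott_param_eq[k ->] :
    bott_param B y = bott_param B (b (bott_param B y)).
    by rewrite bP.
  by rewrite Sk bott_param_act.
have half (C D : 'M['F_2]_n) (h : real_bott R C -> real_bott R D)
  (H : ('I_n -> R) -> 'I_n -> R) :
    affmap H -> (forall x, h (bott_param C x) = bott_param D (H x)) ->
      smooth_map h.
  move=> Ha hE p; have [x0 x0p] := bott_param_surj p.
  have p2 : 0 < pi / 2 :> R by rewrite divr_gt0 ?pi_gt0.
  pose F (w : 'rV[R]_n) := rowf (H (w 0)).
  have Fc : continuous F.
    move=> w; exact: (@affmap_smooth n H setT Ha 0%N w).
  have inj E (w w' u : 'rV[R]_n) : ball u (pi / 2) w -> ball u (pi / 2) w' ->
      real_bott_param E w = real_bott_param E w' -> w = w'.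
    move=> [_ uw] [_ uw'] ww'; rewrite -[w]rowf_row -[w']rowf_row; congr rowf.
    apply: (@bott_param_sep R n E); first by rewrite /bott_param !rowf_row.
    have := @eclose_trans _ _ _ _ (u 0) (w 0) (w' 0)
      (eclose_sym (fun j => uw 0 j)) (fun j => uw' 0 j).
    by rewrite -splitr.
  exists (ball (rowf x0) (pi / 2) `&` F @^-1`
    (ball (F (rowf x0)) (pi / 2)))%classic,
    (ball (F (rowf x0)) (pi / 2)), F; split.
  - split; last first.
      by move=> w w'; rewrite !inE => -[w1 _] [w1' _]; exact: inj w1 w1'.
    apply: openI; first exact: ball_open.
    by apply: open_comp; [move=> w _; exact: Fc|exact: ball_open].
  - split; first exact: ball_open.
    by move=> w w'; rewrite !inE; exact: inj.
  - exists (rowf x0); last exact: x0p.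
    by split; exact: ballxx.
  - exact: affmap_smooth.
  - move=> w [_ Fw]; split => //.
    by have := hE (w 0); rewrite /bott_param rowf_row.
exists f, g; split; last 2 first.
- exact: (half _ _ _ T).
- exact: (half _ _ _ S).
- by move=> p; rewrite -[p]aP fE gE TK.
- by move=> p; rewrite -[p]bP gE fE SK.
Qed.

Section Operations.
Variable I : finType.
Implicit Types N : I -> I -> 'F_2.

Lemma affequiv_reindex (J : finType) N (N' : J -> J -> 'F_2) (g : J -> I) :
  bijective g -> (forall a b, N' a b = N (g a) (g b)) -> affequiv N N'.
Proof.
move=> [g' gK g'K] NE.
exists (fun x j => x (g j)), (fun y i => y (g' i)),
  (fun k j => k (g j)), (fun k i => k (g' i)); split.
- by split => i; exact: afffun_coord.
- by move=> x; apply/funext => i; rewrite g'K.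
- by move=> y; apply/funext => j; rewrite gK.
- move=> k x; apply/funext => j; rewrite /act; congr ((sgn2 _)%:~R * _ + _).
  rewrite /hol (reindex g) /=; last by exists g' => i _.
  by apply: eq_bigr => a _; rewrite NE.
- move=> k x; apply/funext => i; rewrite /act; congr ((sgn2 _)%:~R * _ + _).
  rewrite /hol (reindex g') /=; last by exists g => a _.
  by apply: eq_bigr => a _; rewrite NE !g'K.
Qed.

Lemma affequiv_eq N N' : (forall i j, N i j = N' i j) -> affequiv N N'.
Proof. by move=> NN; apply: (@affequiv_reindex _ _ _ id) => //; exists id. Qed.

(* The shear x_p |-> x_p + sum_i c_i x_i *)
Lemma affequiv_pivot N N' p (c : I -> 'F_2) :
  N p p = 0 -> c p = 0 -> (forall i, c i <> 0 -> forall a, N a i = N a p) ->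
  (forall i j, N' i j = N i j + c i * N p j) -> affequiv N N'.
Proof.
move=> Npp cp Nc NE.
(* An integral lift of c, so that the shear preserves the lattice pi Z^I. *)
pose d i : int := if c i == 0 then 0 else 1.
have dF i : (d i)%:~R = c i.
  by rewrite /d; case: (F2P (c i)) => ->.
pose T (s : int) (x : I -> R) : I -> R :=
  fun j => x j + (if j == p then 1 else 0) * (s%:~R * \sum_i (d i)%:~R * x i).
pose phi (s : int) (k : I -> int) : I -> int :=
  fun j => k j + (if j == p then 1 else 0) * (s * \sum_i d i * k i).
have dp : d p = 0 by rewrite /d cp.
have Ta s : affmap (T s).
  move=> j; apply: afffunD; first exact: afffun_coord.
  by do 2![apply: afffunZ]; apply: afffun_sum => i; apply/afffunZ/afffun_coord.
have Tsum s x : \sum_i (d i)%:~R * T s x i = \sum_i (d i)%:~R * x i.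
  apply: eq_bigr => i _; rewrite /T.
  by case: eqP => [->|_]; rewrite ?dp ?mulr0z !mul0r ?addr0.
have TK s : cancel (T s) (T (- s)).
  move=> x; apply/funext => j; rewrite {1}/T Tsum {1}/T.
  by rewrite -addrA -mulrDr -mulrDl -intrD subrr mulr0z mul0r mulr0 addr0.
(* Stated for a general pair of matrices and any odd s: the inverse shear has s = -1 and exchanges N
   and N', the change of matrix being its own inverse modulo 2. *)
have Tk N1 N2 s : (s%:~R = 1 :> 'F_2) -> N1 p p = 0 ->
    (forall i, c i <> 0 -> forall a, N1 a i = N1 a p) ->
    (forall i j, N2 i j = N1 i j + c i * N1 p j) ->
    forall k x, T s (act N1 k x) = act N2 (phi s k) (T s x).
  move=> s1 N1pp N1c N2E k x.
  have holE j : hol N2 (phi s k) j = hol N1 k j.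
    rewrite /hol.
    pose S := \sum_i c i * (k i)%:~R.
    have e1 : N1 p j * S = \sum_i N1 i j * ((if i == p then 1 else 0) * S).
      rewrite [RHS](bigD1 p) //= eqxx mul1r big1 ?addr0 // => i /negPf ->.
      by rewrite mul0r mulr0.
    have e2 : N1 p j * S = \sum_i c i * N1 p j * (k i)%:~R.
      by rewrite /S mulr_sumr; apply: eq_bigr => i _; ring.
    have -> : \sum_i N2 i j * (phi s k i)%:~R =
        \sum_i N1 i j * (k i)%:~R + N1 p j * S + N1 p j * S.
      rewrite {1}e1 e2 -!big_split /=; apply: eq_bigr => i _.
      rewrite N2E /phi intrD !intrM s1 mul1r.
      have -> : (\sum_i d i * k i)%:~R = S.
        by rewrite rmorph_sum; apply: eq_bigr => h _; rewrite /= intrM dF.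
      by case: eqP => [->|_]; rewrite ?cp; ring.
    by rewrite -addrA F2D addr0.
  apply/funext => j; rewrite /T /act holE /phi.
  have -> : \sum_i (d i)%:~R * ((sgn2 (hol N1 k i))%:~R * x i + (k i)%:~R * pi)
    =
      (sgn2 (hol N1 k p))%:~R * (\sum_i (d i)%:~R * x i) +
        (\sum_i d i * k i)%:~R * pi.
    rewrite rmorph_sum mulr_sumr mulr_suml -big_split /=; apply: eq_bigr => i _.
    rewrite intrM; have [ci|/eqP ci] := eqVneq (c i) 0.
      by rewrite /d ci eqxx !mul0r mulr0 addr0.
    have -> : hol N1 k i = hol N1 k p by apply: eq_bigr => a _; rewrite N1c.
    by move: (@pi R) => q; ring.
  rewrite intrD !intrM; move: (@pi R) => q.
  by case: eqP => [->|_]; ring.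
have N'p j : N' p j = N p j by rewrite NE cp mul0r addr0.
have sym i j : N i j = N' i j + c i * N' p j.
  by rewrite N'p NE -addrA F2D addr0.
have N'c i : c i <> 0 -> forall a, N' a i = N' a p.
  by move=> ci a; rewrite !NE !(Nc i ci).
exists (T 1%R), (T (- 1)%R), (phi 1%R), (phi (- 1)%R); split => //.
- exact: Tk.
- by apply: Tk => //; rewrite ?N'p //; apply: val_inj.
Qed.

(* Translation by a quarter turn of the p-th coordinate *)
Lemma affequiv_shift N N' p :
  N p p = 0 -> (forall i j, N' i j = N i j + N i p * N p j) -> affequiv N N'.
Proof.
move=> Npp NE.
pose T (s : int) (x : I -> R) : I -> R :=
  fun j => x j + (if j == p then s%:~R * (pi / 2) else 0).
(* Translation by s pi / 2 conjugates the reflection x |-> -x + c into x |-> -x + c + s pi, and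
   leaves translations unchanged. *)
pose phi N1 (s : int) (k : I -> int) : I -> int :=
  fun j => k j + (if j == p then (if hol N1 k p == 0 then 0 else s) else 0).
have Ta s : affmap (T s).
  by move=> j; apply: afffunD; [exact: afffun_coord|exact: afffun_cst].
have TK s : cancel (T s) (T (- s)).
  move=> x; apply/funext => j; rewrite /T -addrA; case: eqP => _.
    by rewrite -mulrDl -intrD subrr mulr0z mul0r addr0.
  by rewrite !addr0.
have Tk N1 N2 s : (s%:~R = 1 :> 'F_2) -> N1 p p = 0 ->
    (forall i j, N2 i j = N1 i j + N1 i p * N1 p j) ->
    forall k x, T s (act N1 k x) = act N2 (phi N1 s k) (T s x).
  move=> s1 N1pp N2E k x.
  have holE j : hol N2 (phi N1 s k) j = hol N1 k j.
    have phiF i : (phi N1 s k i)%:~R = (k i)%:~R + (i == p)%:R * hol N1 k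
      p :> 'F_2.
      rewrite /phi intrD; congr (_ + _); case: eqP => _; last by rewrite mul0r.
      by rewrite mul1r; case: (F2P (hol N1 k p)) => ->.
    have sump (u : I -> 'F_2) : \sum_i u i * (phi N1 s k i)%:~R =
        \sum_i u i * (k i)%:~R + u p * hol N1 k p.
      have -> : u p * hol N1 k p = \sum_i u i * ((i == p)%:R * hol N1 k p).
        rewrite (bigD1 p) //= eqxx mul1r big1 ?addr0 // => i /negPf ->.
        by rewrite mul0r mulr0.
      by rewrite -big_split; apply: eq_bigr => i _; rewrite phiF mulrDr.
    rewrite /hol sump -/(hol N1 k p) N2E N1pp mul0r addr0.
    have -> : \sum_i N2 i j * (k i)%:~R =
        \sum_i N1 i j * (k i)%:~R + N1 p j * hol N1 k p.
      rewrite /hol mulr_sumr -big_split; apply: eq_bigr => i _.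
      by rewrite N2E /=; ring.
    by rewrite -addrA F2D addr0.
  apply/funext => j; rewrite /T /act holE /phi.
  case: eqP => [->|_]; last by rewrite !addr0.
  move: (@pi R) => q; case: (F2P (hol N1 k p)) => -> /=.
    by rewrite addr0 mul1r addrAC mul1r.
  by rewrite sgn2_1 intrD; field.
have N'p j : N' p j = N p j by rewrite NE Npp mul0r addr0.
have N'ip i : N' i p = N i p by rewrite NE Npp mulr0 addr0.
have sym i j : N i j = N' i j + N' i p * N' p j.
  by rewrite N'p N'ip NE -addrA F2D addr0.
exists (T 1%R), (T (- 1)%R), (phi N 1%R), (phi N' (- 1)%R); split => //.
- exact: Tk.
- by apply: Tk => //; rewrite ?N'p //; apply: val_inj.
Qed.

End Operations.

End AffineMaps.

(** * Twisted products *)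

Definition glue (I J : finType) (C : I -> J -> 'F_2) (E : J -> J -> 'F_2)
    (a b : I + J) : 'F_2 :=
  match a, b with
  | inl i, inr j => C i j
  | inr i, inr j => E i j
  | _, inl _ => 0
  end.

Lemma bottN_bott n (A : 'M['F_2]_n) i j :
  bott_matrix A -> i != j -> bottN A i j = A i j.
Proof.
move=> [_ A0] ij; rewrite /bottN; case: ifP => // /negbT.
rewrite -leqNgt leq_eqVlt => /orP[/eqP/val_inj e|/A0 ->] //.
by rewrite e eqxx in ij.
Qed.

Lemma bottNii n (A : 'M['F_2]_n) i : bottN A i i = 0.
Proof. by rewrite /bottN ltnn. Qed.

Section Blocks.
Variables (k m : nat).
Implicit Types (A : 'M['F_2]_(k + m)) (C : 'M['F_2]_(k, m)) (B : 'M['F_2]_m).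

Lemma twisted_block A C B (sigma : 'S_(k + m)) :
  bott_matrix A ->
  (forall i j : 'I_m, (i < j)%N -> (sigma (rshift k i) < sigma (rshift k j))%N)
    ->
  mxsub sigma sigma A = block_mx 1%:M C 0 B ->
  bott_matrix B /\ exists2 g : 'I_k + 'I_m -> 'I_(k + m), bijective g &
    forall a b, glue C (bottN B) a b = bottN A (g a) (g b).
Proof.
move=> bA sig AE.
have AEij i j : A (sigma i) (sigma j) = block_mx 1%:M C 0 B i j.
  by rewrite -AE mxE.
have bB : bott_matrix B.
  split=> [i|i j ji].
    by have := AEij (rshift k i) (rshift k i); rewrite block_mxEdr bA.1 => ->.
  have := AEij (rshift k i) (rshift k j); rewrite block_mxEdr => <-.
  by apply: bA.2; exact: sig.
split=> //; exists (fun a => sigma (unsplit a)).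
  apply: bij_comp; first by exists (perm_inv sigma);
    [exact: permK|exact: permKV].
  by exists (@fintype.split k m); [exact: unsplitK|exact: splitK].
move=> a b.
have [<-|ab] := eqVneq a b.
  by rewrite bottNii; case: a => i //=; rewrite bottNii.
rewrite bottN_bott //; last first.
  by rewrite (inj_eq perm_inj) (inj_eq (can_inj (@unsplitK _ _))).
rewrite AEij; case: a b ab => [i|i] [j|j] /= ab.
- have /negPf ij : i != j by apply/eqP => e; rewrite e eqxx in ab.
  by rewrite block_mxEul mxE ij.
- by rewrite block_mxEur.
- by rewrite block_mxEdl mxE.
- by rewrite block_mxEdr bottN_bott //; apply/eqP => e; rewrite e eqxx in ab.
Qed.

(** The diagonal entry of B is always one nonzero entry; a second one lies in C or off the diagonal
    of B. *)
Lemma col_nontrivial C B j : bott_matrix B ->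
  (1 < #|[pred i | col_mx C B i j != 0%R]|)%N <->
  (exists i, C i j <> 0) \/ (exists i, bottN B i j <> 0).
Proof.
move=> bB; split.
  move=> /card_gt1P[x [y [xP yP xy]]].
  have [i [ij iP]] : exists i, i != rshift k j /\ col_mx C B i j != 0.
    have [xj|xj] := eqVneq x (rshift k j); last by exists x.
    by exists y; split=> //; rewrite -xj eq_sym.
  move: ij iP; rewrite -(splitK i); case: (fintype.split i) => a /= aj.
    by rewrite col_mxEu => /eqP; left; exists a.
  rewrite col_mxEd => /eqP Ba; right; exists a; rewrite bottN_bott //.
  by apply/eqP => e; rewrite e eqxx in aj.
move=> H; apply/card_gt1P; exists (rshift k j).
have jP : rshift k j \in [pred i | col_mx C B i j != 0].
  by rewrite inE /= col_mxEd bB.1 oner_eq0.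
case: H => -[i iP].
  exists (lshift m i); split => //; last by rewrite eq_sym eq_lrshift.
  by rewrite inE /= col_mxEu; apply/eqP.
have ij : i != j by apply/eqP => e; apply: iP; rewrite e bottNii.
exists (rshift k i); split => //; last by rewrite eq_rshift eq_sym.
by rewrite inE /= col_mxEd -bottN_bott //; apply/eqP.
Qed.

Lemma twisted_product_elim s (X : 'M['F_2]_m -> Prop) A :
  twisted_product (k := k) s X A ->
  bott_matrix A /\ exists C B, [/\ bott_matrix B /\ X B, \rank C = s,
    exists2 g : 'I_k + 'I_m -> 'I_(k + m), bijective g &
      forall a b, glue C (bottN B) a b = bottN A (g a) (g b) &
    forall j, (exists i, C i j <> 0) \/ (exists i, bottN B i j <> 0)].
Proof.
move=> [bA [sigma [C [B [[_ sig] AE cols rC XB]]]]]; split=> //.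
have [bB gE] := twisted_block bA sig AE.
by exists C, B; split => // j; apply/col_nontrivial.
Qed.

Lemma twisted_product_intro s (X : 'M['F_2]_m -> Prop) C B :
  bott_matrix B -> X B -> \rank C = s ->
  (forall j, (exists i, C i j <> 0) \/ (exists i, bottN B i j <> 0)) ->
  twisted_product (k := k) s X (block_mx 1%:M C 0 B) /\
  exists2 g : 'I_k + 'I_m -> 'I_(k + m), bijective g &
      forall a b, glue C (bottN B) a b = bottN (block_mx 1%:M C 0 B)
        (g a) (g b).
Proof.
move=> bB XB rC cols.
have bA : bott_matrix (block_mx 1%:M C 0 B).
  split=> [i|i j].
    rewrite -(splitK i); case: (fintype.split i) => a /=.
      by rewrite block_mxEul mxE eqxx.
    by rewrite block_mxEdr bB.1.
  rewrite -(splitK i) -(splitK j); case: (fintype.split i) => a;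
    case: (fintype.split j) => b /= ba.
  - by rewrite block_mxEul mxE; case: eqP ba => // ->; rewrite ltnn.
  - by move: ba; have := ltn_ord a; lia.
  - by rewrite block_mxEdl mxE.
  - by rewrite block_mxEdr bB.2 //; lia.
have sub1 : mxsub (1 : 'S_(k + m))%g (1 : 'S_(k + m))%g (block_mx 1%:M C 0 B)
    = block_mx 1%:M C 0 B :> 'M['F_2]_(k + m).
  by apply/matrixP => i j; rewrite mxE !perm1.
have lt1 (i j : 'I_m) : (i < j)%N ->
    ((1 : 'S_(k + m))%g (rshift k i) < (1 : 'S_(k + m))%g (rshift k j))%N.
  by move=> ij; rewrite !perm1 /=; lia.
split; last by have [] := twisted_block bA lt1 sub1.
split=> //; exists 1%g, C, B; split => //.
  by split => // i j ij; rewrite !perm1.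
by move=> j; apply/col_nontrivial.
Qed.

End Blocks.

Section Families.
Variable R : realType.

Lemma glue_reindex (I J K : finType) (C : I -> J -> 'F_2) E (g : K -> J) C' E' :
  bijective g -> (forall i a, C' i a = C i (g a)) ->
  (forall a b, E' a b = E (g a) (g b)) -> affequiv R (glue C E) (glue C' E').
Proof.
move=> [g' gK g'K] CE EE.
apply: (@affequiv_reindex R _ _ _ _ (fun a : I + K =>
  match a with inl i => inl i | inr x => inr (g x) end)).
  exists (fun a : I + J => match a with inl i => inl i | inr x =>
    inr (g' x) end).
    by case=> // x; rewrite gK.
  by case=> // x; rewrite g'K.
by move=> [i|x] [j|y] //=; rewrite ?CE ?EE.
Qed.

Variables (Y Z : finType).
Implicit Types (d : Z -> 'F_2) (C : Y -> Z -> 'F_2) (E : Z -> Z -> 'F_2).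

(* The linking data of S^1 x_{Z_2} (T^Y x_{(Z_2)^s} M(E)): the first generator
   acts on every coordinate of T^Y, and on those of M(E) according to d. *)
Definition fam d C E : 'I_1 + (Y + Z) -> 'I_1 + (Y + Z) -> 'F_2 :=
  glue (fun _ b => match b with inl _ => 1 | inr z => d z end) (glue C E).

Lemma fam_eq d d' C C' E E' : d =1 d' -> C =2 C' -> E =2 E' ->
  affequiv R (fam d C E) (fam d' C' E').
Proof.
move=> dd CC EE; apply: affequiv_eq => -[i|[y|z]] [j|[y'|z']] //=.
Qed.

Lemma fam_reindex d C E (gy : Y -> Y) (gz : Z -> Z) :
  bijective gy -> bijective gz ->
  affequiv R (fam d C E) (fam (fun z => d (gz z)) (fun y z => C (gy y) (gz z))
    (fun z z' => E (gz z) (gz z'))).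
Proof.
move=> [gy' gyK gy'K] [gz' gzK gz'K].
apply: (@glue_reindex _ _ _ _ _ (fun a => match a with inl y => inl (gy y)
  | inr z => inr (gz z) end)).
- exists (fun a => match a with inl y => inl (gy' y) | inr z =>
  inr (gz' z) end).
    by case=> x; rewrite ?gyK ?gzK.
  by case=> x; rewrite ?gy'K ?gz'K.
- by move=> i [y|z].
- by move=> [y|z] [y'|z'].
Qed.

(** All coordinates of T^Y have the same holonomy, so shears between them are allowed; on C they are
    row operations with pivot row p. *)
Lemma fam_pivot d C E p (c : Y -> 'F_2) : c p = 0 ->
  affequiv R (fam d C E) (fam d (fun y z => C y z + c y * C p z) E).
Proof.
move=> cp; apply: (@affequiv_pivot R _ _ _ (inr (inl p))
  (fun a => match a with inr (inl y) => c y | _ => 0 end)) => //.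
  by move=> [i|[y|z]] //= _ [j|[y'|z']].
by move=> [i|[y|z]] [j|[y'|z']] //=; rewrite ?mulr0 ?mul0r ?addr0.
Qed.

(** Only the base generator conjugates the coordinate p of T^Y, so translating that coordinate by pi
    / 2 adds row p of C to d and changes nothing else. *)
Lemma fam_shift d C E p :
  affequiv R (fam d C E) (fam (fun z => d z + C p z) C E).
Proof.
apply: (@affequiv_shift R _ _ _ (inr (inl p))) => //.
by move=> [i|[y|z]] [j|[y'|z']] //=; rewrite ?mulr0 ?mul0r ?mul1r ?addr0.
Qed.

(** For the Klein fibre and its first coordinate p, this adds the first column of d and C to the
    second one. *)
Lemma fam_shift_last d C E p : E p p = 0 ->
  affequiv R (fam d C E) (fam (fun z => d z + d p * E p z)
    (fun y z => C y z + C y p * E p z) (fun z' z => E z' z + E z' p * E p z)).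
Proof.
move=> Epp; apply: (@affequiv_shift R _ _ _ (inr (inr p))) => //.
by move=> [i|[y|z]] [j|[y'|z']] //=; rewrite ?mulr0 ?mul0r ?mul1r ?addr0.
Qed.

End Families.

Lemma I2P (z : 'I_2) : z = ord0 \/ z = ord_max.
Proof. by case: z => [[|[|//]] i]; [left|right]; apply: val_inj. Qed.

Lemma perm_bij (T : finType) (s : {perm T}) : bijective s.
Proof. by exists (perm_inv s); [exact: permK|exact: permKV]. Qed.

Lemma id_bij (T : Type) : bijective (@id T).
Proof. by exists id. Qed.

(** * Reduction of d and C to three normal forms when the fibre is a surface *)

Section Columns.
Variables (R : realType) (k : nat) (k2 : (2 <= k)%N).
Implicit Types (C : 'I_k -> 'I_2 -> 'F_2) (E : 'I_2 -> 'I_2 -> 'F_2).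

Definition nf_equal (y : 'I_k) (z : 'I_2) : 'F_2 := (val y == 0%N)%:R.
Definition nf_indep (y : 'I_k) (z : 'I_2) : 'F_2 := (val y == val z)%:R.

(** Row operations leave two shapes of C, according to whether its columns are equal or independent.
    With equal columns the only nonzero row is (1, 1); adding it to d preserves the sum of the two
    entries of d, whose values 0 and 1 give the first two forms. With independent columns the rows
    (1, 0) and (0, 1) clear d. *)
Definition nf E (t : 'I_3) : 'I_1 + ('I_k + 'I_2) ->
  'I_1 + ('I_k + 'I_2) -> 'F_2 :=
  match val t with
  | 0%N => fam (fun=> 0) nf_equal E
  | 1%N => fam (fun z => (val z == 1%N)%:R) nf_equal E
  | _ => fam (fun=> 0) nf_indep E
  end.

Let y0 : 'I_k := Ordinal (ltnW k2).
Let y1 : 'I_k := Ordinal k2.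

Lemma neq0_witness (I : finType) (l : I -> 'F_2) : (exists y, l y <> 0) ->
  exists y, l y = 1.
Proof. by move=> [y /F2_neq0 ly]; exists y. Qed.

Lemma fam_equal d C E : (exists y, C y ord0 <> 0) ->
  (forall y, C y ord_max = C y ord0) ->
  exists t : 'I_3, affequiv R (fam d C E) (nf E t).
Proof.
move=> /neq0_witness[p Cp] CC.
have CC' y z : C y z = C y ord0 by case: (I2P z) => ->.
have step1 :=
  fam_pivot R d C E (p := p) (c := fun y => if y == p then 0 else C y ord0).
rewrite eqxx in step1; have {}step1 := step1 erefl.
have step2 :=
  fam_reindex R d (fun y z => C y z + (if y == p then 0 else C y ord0) * C p z)
  E
  (perm_bij (tperm y0 p)) (@id_bij 'I_2).
have {step1} step2 := affequiv_trans step1 step2.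
have step3 := fam_shift R d nf_equal E y0.
have Heq : affequiv R (fam d C E) (fam d nf_equal E).
  apply: affequiv_trans step2 _; apply: fam_eq => // y z.
  rewrite CC' [C p z]CC' Cp mulr1 /nf_equal.
  have -> : (tperm y0 p y == p) = (val y == 0%N).
    by rewrite -{2}[p](tpermL y0 p) (inj_eq perm_inj) -val_eqE.
  case: eqP => [e|_]; last by rewrite F2D.
  have -> : y = y0 by apply: val_inj; rewrite /= e.
  by rewrite tpermL Cp addr0.
have Heq2 : affequiv R (fam d C E) (fam (fun z => d z + d ord0) nf_equal E).
  apply: affequiv_trans Heq _; case: (F2P (d ord0)) => d0.
    by apply: fam_eq => // z; rewrite d0 addr0.
  apply: affequiv_trans step3 _; apply: fam_eq => // z.
  by rewrite /nf_equal /= d0.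
case: (F2P (d ord_max + d ord0)) => dd.
  exists ord0; apply: affequiv_trans Heq2 _; apply: fam_eq => // z.
  by case: (I2P z) => ->; rewrite ?dd ?F2D.
exists (@Ordinal 3 1 isT); apply: affequiv_trans Heq2 _; apply: fam_eq => // z.
by case: (I2P z) => ->; rewrite ?dd ?F2D.
Qed.

Lemma perm_two (p q : 'I_k) : p <> q -> exists s : 'S_k, s y0 = p /\ s y1 = q.
Proof.
move=> pq; pose w := tperm y0 p y1.
have y01 : y0 != y1 by [].
have wp : w != p.
  by rewrite /w -{2}[p](tpermL y0 p) (inj_eq perm_inj) eq_sym.
exists (tperm y0 p * tperm w q)%g; rewrite !permM tpermL; split.
  by rewrite tpermD //; apply/eqP => // e; apply: pq.
by rewrite -/w tpermL.
Qed.

(** Two distinct nonzero columns over F_2 are independent. Hence after the pivot on the first column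
    the second one has a nonzero entry outside row p, which serves as the second pivot. *)
Lemma fam_indep d C E : (exists y, C y ord0 <> 0) ->
  (exists y, C y ord_max <> 0) ->
  (exists y, C y ord_max <> C y ord0) ->
  affequiv R (fam d C E) (nf E (@Ordinal 3 2 isT)).
Proof.
move=> /neq0_witness[p Cp] C1 CC.
pose c1 y := if y == p then 0 else C y ord0.
have step1 : affequiv R (fam d C E) (fam d (fun y z => C y z + c1 y * C p z) E).
  by apply: fam_pivot; rewrite /c1 eqxx.
pose C' y z := C y z + c1 y * C p z.
have C'0 y : C' y ord0 = (y == p)%:R.
  by rewrite /C' /c1 Cp mulr1; case: eqP => [->|_]; rewrite ?Cp ?addr0 ?F2D.
have [q qp C'q] : exists2 q, q <> p & C' q ord_max = 1.
  apply: contrapT => nq.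
  have C'1 y : y <> p -> C' y ord_max = 0.
    by move=> yp; apply: F2_neq1 => /F2_neq0 ?; apply: nq; exists y.
  have col y : C y ord_max = C y ord0 * C p ord_max.
    have [->|/eqP yp] := eqVneq y p; first by rewrite Cp mul1r.
    have := C'1 y yp; rewrite /C' /c1; move/eqP/negPf: (yp) => ->.
    by move/eqP; rewrite addr_eq0 F2N => /eqP.
  case: (F2P (C p ord_max)) => e.
    by case: C1 => y; rewrite col e mulr0.
  by case: CC => y; rewrite col e mulr1.
pose c2 y := if y == q then 0 else C' y ord_max.
have step2 :
  affequiv R (fam d C' E) (fam d (fun y z => C' y z + c2 y * C' q z) E).
  by apply: fam_pivot; rewrite /c2 eqxx.
have [s [sp sq]] := perm_two (fun e => qp (esym e)).
have step3 := fam_reindex R d (fun y z => C' y z + c2 y * C' q z) E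
  (perm_bij s) (@id_bij 'I_2).
have H : affequiv R (fam d C E) (fam d nf_indep E).
  apply: affequiv_trans step1 (affequiv_trans step2 (affequiv_trans step3 _)).
  apply: fam_eq => // y z; rewrite /nf_indep; case: (I2P z) => ->.
    rewrite !C'0; move/eqP/negPf: (qp) => ->; rewrite mulr0 addr0.
    by rewrite -sp (inj_eq perm_inj) -val_eqE.
  rewrite C'q mulr1 /c2.
  have -> : (s y == q) = (val y == val (ord_max : 'I_2)).
    by rewrite -sq (inj_eq perm_inj) -val_eqE.
  case: eqP => [e|_]; last by rewrite F2D.
  have -> : y = y1 by apply: val_inj; rewrite /= e.
  by rewrite sq C'q addr0.
(* [inord] reads a row index as a column index; it is applied to the rows 0 and 1 only, which are
   the two unit vectors. *)
have red (u : 'I_k) d1 : affequiv R (fam d1 nf_indep E)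
    (fam (fun z => d1 z + (if d1 (inord u) == 0 then 0 else nf_indep u z))
      nf_indep E).
  case: eqP => _; first by apply: fam_eq => // z; rewrite addr0.
  exact: fam_shift.
apply: affequiv_trans H
  (affequiv_trans (red y0 _) (affequiv_trans (red y1 _) _)).
rewrite /nf /=; apply: fam_eq => // z.
have -> : inord y0 = ord0 :> 'I_2 by apply: val_inj; rewrite /= inordK.
have -> : inord y1 = ord_max :> 'I_2 by apply: val_inj; rewrite /= inordK.
have n00 : nf_indep y0 ord0 = 1 by [].
have n01 : nf_indep y0 ord_max = 0 by [].
have n10 : nf_indep y1 ord0 = 0 by [].
have n11 : nf_indep y1 ord_max = 1 by [].
case: (I2P z) => ->; rewrite ?n00 ?n01 ?n10 ?n11.
  by case: (F2P (d ord0)) => ->; rewrite /= ?F2D ?add0r; case: ifP.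
by case: (F2P (d ord0)) => ->; case: (F2P (d ord_max)) => ->; apply/eqP.
Qed.

End Columns.

Section Nested.
Variable R : realType.

(** The constant 1 in [fam] is forced: nothing in B conjugates the coordinates of T^k, so the second
    nonzero entry in each of their columns of A must come from the base generator. *)
Lemma nested_elim k m s (X : 'M['F_2]_(k + m) -> Prop) (X' : 'M['F_2]_m ->
  Prop) A :
  (forall B, X B -> exists s', twisted_product (k := k) s' X' B) ->
  twisted_product (k := 1) s X A ->
  bott_matrix A /\ exists d (C : 'I_k -> 'I_m -> 'F_2) B,
    [/\ bott_matrix B, X' B, affequiv R (bottN A) (fam d C (bottN B)) &
     forall z, (exists y, C y z <> 0) \/ (exists z', bottN B z' z <> 0)].
Proof.
move=> XX' /twisted_product_elim[bA [c [B [[bB XB] _ [g gb gE] colA]]]].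
split=> //;
  have [s' /twisted_product_elim[_ [C [B' [[bB' XB'] _ [h hb hE] colB]]]]] :=
  XX' B XB.
exists (fun z => c ord0 (h (inr z))), C, B'; split => //.
apply: affequiv_trans (affequiv_reindex R gb gE) _.
apply: (glue_reindex R hb) => // i [y|z] /=; last by rewrite (ord1 i).
case: (colA (h (inl y))) => -[j].
  by rewrite (ord1 i) (ord1 j) => /F2_neq0.
case: hb => h' _ h'K; rewrite -[j]h'K -hE.
by case: (h' j).
Qed.

Lemma mxrank_rV_neq0 m (v : 'rV['F_2]_m) j : v 0 j <> 0 -> \rank v = 1%N.
Proof.
move=> vj; have : (0 < \rank v)%N.
  by rewrite lt0n mxrank_eq0; apply/eqP => v0; apply: vj; rewrite v0 mxE.
by have := rank_leq_row v; lia.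
Qed.

(** The row of the base generator is 1 on T^k and d on the fibre. As k > 0 it is nonzero, hence of
    rank one, and the columns of the fibre are nontrivial already in B. *)
Lemma nested_intro k m s' (X : 'M['F_2]_(k + m) -> Prop)
  (X' : 'M['F_2]_m -> Prop)
    d (C : 'M['F_2]_(k, m)) B :
  (0 < k)%N ->
  (forall B, twisted_product (k := k) s' X' B -> X B) ->
  bott_matrix B -> X' B -> \rank C = s' ->
  (forall z, (exists y, C y z <> 0) \/ (exists z', bottN B z' z <> 0)) ->
  exists A, twisted_product (k := 1) 1 X A /\ bott_matrix A /\
    affequiv R (bottN A) (fam d C (bottN B)).
Proof.
move=> k0 XX' bB XB rC colB.
have [tB [h hb hE]] := twisted_product_intro bB XB rC colB.
pose B1 := block_mx 1%:M C 0 B; rewrite -/B1 in tB hE.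
case: hb => h' hK h'K.
have bB1 : bott_matrix B1 by case: tB.
pose c : 'rV['F_2]_(k + m) := \row_j match h' j with inl _ =>
  1 | inr z => d z end.
have rc : \rank c = 1%N.
  apply: (mxrank_rV_neq0 (j := h (inl (Ordinal k0)))).
  by rewrite mxE hK; exact: F2_1_neq0.
have colA j : (exists i, c i j <> 0) \/ (exists i, bottN B1 i j <> 0).
  rewrite -[j]h'K; case: (h' j) => [y|z].
    by left; exists 0; rewrite mxE hK; exact: F2_1_neq0.
  right; case: (colB z) => -[a aP]; [exists (h (inl a))|exists (h (inr a))];
    by rewrite -hE.
have [tA [g gb gE]] := twisted_product_intro bB1 (XX' _ tB) rc colA.
exists (block_mx 1%:M c 0 B1); split => //; split; first by case: tA.
apply: affequiv_trans (affequiv_reindex R gb gE) _.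
have hb : bijective h by exists h'.
by apply: (glue_reindex R hb) => // i [y|z] /=; rewrite ord1 mxE hK.
Qed.

Lemma bottN1 m : bottN (1%:M : 'M['F_2]_m) = (fun _ _ => 0).
Proof.
apply/funext => i; apply/funext => j; rewrite /bottN mxE.
by case: ltnP => // ij; case: eqP ij => // ->; rewrite ltnn.
Qed.

(** An entry N' i j = 1 prevents the generators i and j from commuting. This recognises the torus
    among the M(B) by its fundamental group. *)
Lemma grpiso_abelian (I J : finType) (N : I -> I -> 'F_2)
  (N' : J -> J -> 'F_2) :
  grpiso N N' -> N = (fun _ _ => 0) -> acyclic N' -> N' = (fun _ _ => 0).
Proof.
move=> [f [g [fK gK fM]]] N0 [r [r_inj Nr]].
have comm k l : gmul N' k l = gmul N' l k.
  have H (k1 l1 : I -> int) : gmul N k1 l1 = gmul N l1 k1.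
    have hol0 k2 i : hol N k2 i = 0 by rewrite /hol N0 big1 // => j _;
      rewrite mul0r.
    by apply/funext => i; rewrite /gmul !hol0 !mul1r addrC.
  by rewrite -(gK k) -(gK l) -!fM H.
apply/funext => i; apply/funext => j; apply: F2_neq1 => Nij.
have ij : (i == j) = false.
  by apply/negP => /eqP e; have := Nr _ _ Nij; rewrite e ltnn.
have := congr1 (fun h => h j) (comm (unit_at i 1) (unit_at j 1)).
rewrite /gmul !hol_unit /unit_at eqxx eq_sym ij (F2_neq0 Nij) !mulr1.
by rewrite sgn2_1 mulr0.
Qed.

Lemma is_torus_bottN m (B : 'M['F_2]_m) : is_torus R B ->
  bottN B = (fun _ _ => 0).
Proof.
move=> [_ /diffeo_grpiso/grpiso_sym iso].
by apply: (grpiso_abelian iso); [exact: bottN1|exact: bottN_acyclic].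
Qed.

Lemma bott_matrix1 m : bott_matrix (1%:M : 'M['F_2]_m).
Proof.
split=> [i|i j ji]; rewrite mxE ?eqxx //.
by case: eqP ji => // ->; rewrite ltnn.
Qed.

Lemma is_torus1 m : is_torus R (1%:M : 'M['F_2]_m).
Proof.
split; first exact: bott_matrix1.
by apply: affequiv_diffeo; exact: affequiv_eq.
Qed.

Definition klein_mx : 'M['F_2]_2 := \matrix_(i < 2, j < 2) (i <= j)%N%:R.

Definition kleinN (i j : 'I_2) : 'F_2 := (i < j)%N%:R.

Lemma bottN_klein : bottN klein_mx = kleinN.
Proof.
apply/funext => i; apply/funext => j; rewrite /bottN /kleinN mxE.
by case: (ltnP i j) => // /ltnW ->.
Qed.

(** A Bott matrix of size 2 has a single free entry, and it is not 0 because the group of the Klein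
    bottle is not abelian. *)
Lemma is_klein_bottle_bottN (B : 'M['F_2]_2) : is_klein_bottle R B ->
  bottN B = kleinN.
Proof.
move=> [bB /diffeo_grpiso iso]; rewrite -/klein_mx bottN_klein in iso.
apply/funext => i; apply/funext => j.
rewrite /kleinN; case: (ltnP i j) => ij; last by rewrite /bottN ltnNge ij.
apply: F2_neq0 => Bij.
have B0 : bottN B = (fun _ _ => 0).
  apply/funext => a; apply/funext => b; rewrite /bottN.
  case: (ltnP a b) => // ab.
  by move: ab ij Bij; case: (I2P a) => ->; case: (I2P b) => ->;
    case: (I2P i) => ->;
    case: (I2P j) => ->.
have := grpiso_abelian iso B0.
rewrite -bottN_klein =>
  /(_ (bottN_acyclic _))/(congr1 (fun h => h ord0 ord_max)).
by rewrite bottN_klein /kleinN /= => /eqP; rewrite oner_eq0.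
Qed.

Lemma is_klein_bottle_klein : is_klein_bottle R klein_mx.
Proof.
split; last by apply: affequiv_diffeo; exact: affequiv_eq.
by split=> [i|i j ji]; rewrite mxE ?leqnn // leqNgt ji.
Qed.

End Nested.

(** * Invariants of the normal forms *)

Definition mkf (Y Z : Type) (a : 'F_2) (b : Y -> 'F_2) (c : Z -> 'F_2)
    (s : 'I_1 + (Y + Z)) : 'F_2 :=
  match s with inl _ => a | inr (inl y) => b y | inr (inr z) => c z end.

Lemma zp_sym (I : finType) (N : I -> I -> 'F_2) u v : zp N u v -> zp N v u.
Proof.
move=> uv i j ij; have := uv i j ij.
by rewrite ![v _ * u _]mulrC addrC.
Qed.

Lemma ann_unit (I : finType) (N : I -> I -> 'F_2) j :
  acyclic N -> annihilated N (fun i => (i == j)%:R).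
Proof.
move=> acN; apply: (annihilated_inh (i := j) _ (zp_col acN j)).
by rewrite eqxx (acyclic_diag j acN) addr0; exact: F2_1_neq0.
Qed.

Lemma ann_unit_col (I : finType) (N : I -> I -> 'F_2) j :
  acyclic N -> annihilated N (fun i => (i == j)%:R + N i j).
Proof.
move=> acN; apply: (annihilated_inh (i := j) _ (zp_sym (zp_col acN j))).
by rewrite eqxx; exact: F2_1_neq0.
Qed.

Section FamRank.
Variables (k m : nat).
Variables (d : 'I_m -> 'F_2) (C : 'I_k -> 'I_m -> 'F_2) (E : 'I_m ->
  'I_m -> 'F_2).
Hypothesis E_lt : forall i j, E i j <> 0 -> (i < j)%N.

Definition fam_rank (s : 'I_1 + ('I_k + 'I_m)) : nat :=
  match s with
  | inl _ => 0
  | inr (inl y) => y.+1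
  | inr (inr z) => k.+1 + z
  end.

Lemma fam_rank_inj : injective fam_rank.
Proof.
move=> [i|[y|z]] [j|[y'|z']] //=.
- by rewrite (ord1 i) (ord1 j).
- by move=> [/val_inj ->].
- by have := ltn_ord y; lia.
- by have := ltn_ord y'; lia.
- by move/addnI/val_inj => ->.
Qed.

Lemma fam_rank_lt i j : fam d C E i j <> 0 -> (fam_rank i < fam_rank j)%N.
Proof.
case: i => [i|[y|z]]; case: j => [j|[y'|z']] //=.
- by move=> _; have := ltn_ord y; lia.
- by move/E_lt; lia.
Qed.

Lemma fam_acyclic : acyclic (fam d C E).
Proof. by exists fam_rank; split; [exact: fam_rank_inj|exact: fam_rank_lt]. Qed.

(** The base coordinate has the zero column, and all coordinates of T^k share one column, the class
    X of the base; the point [y0] ensures that X occurs. *)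
Lemma split_fam a (y0 : 'I_k) : split_class (fam d C E) a =
  [\/ a = @zerof _, a = mkf 1 (fun=> 0) (fun=> 0) |
      exists z, a = mkf (d z) (C ^~ z) (E ^~ z)].
Proof.
apply/propext; rewrite (split_classP fam_acyclic); split.
  move=> [[j|[y|z]] ->].
  - by constructor 1; apply/funext => -[i|[y|z]].
  - by constructor 2; apply/funext => -[i|[y'|z]].
  - by constructor 3; exists z; apply/funext => -[i|[y'|z']].
case=> [->|->|[z ->]].
- by exists (inl ord0); apply/funext => -[i|[y|z]].
- by exists (inr (inl y0)); apply/funext => -[i|[y'|z]].
- by exists (inr (inr z)); apply/funext => -[i|[y'|z']].
Qed.

End FamRank.

Definition split_closed (I : finType) (N : I -> I -> 'F_2) :=
  forall a b, split_class N a -> split_class N b -> split_class N (addf a b).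

Definition three_split (I : finType) (N : I -> I -> 'F_2) :=
  exists a b c, [/\ split_class N a /\ a <> @zerof I,
    split_class N b /\ b <> @zerof I, split_class N c /\ c <> @zerof I
    & [/\ a <> b, a <> c & b <> c]].

Definition split_annihilated (I : finType) (N : I -> I -> 'F_2) :=
  forall a, split_class N a -> annihilated N a.

(** Separates the last two normal forms with Klein fibre: adding X turns the sum X + y_0 + z_0 of
    the second into a zero divisor, while no sum does this for y_1 + z_0 in the third. *)
Definition repairable (I : finType) (N : I -> I -> 'F_2) :=
  exists a b, [/\ split_class N a, split_class N b, a <> b,
    ~ annihilated N b & annihilated N (addf a b)].

Section Transfer.
Variables (I J : finType) (N : I -> I -> 'F_2) (N' : J -> J -> 'F_2).
Hypothesis iso : zpiso N N'.

Lemma split_closed_iso : split_closed N -> split_closed N'.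
Proof.
have [L [[L' LK L'K] LD Ls La]] := zpisoP iso.
move=> H a b; rewrite -[a]L'K -[b]L'K -LD -!Ls; exact: H.
Qed.

Lemma three_split_iso : three_split N -> three_split N'.
Proof.
have [L [[L' LK L'K] LD Ls La]] := zpisoP iso.
have L0 u := additive_neq0 LK LD (u := u).
have Li : injective L by exact: can_inj LK.
move=> [a [b [c [[sa a0] [sb b0] [sc c0] [ab ac bc]]]]].
exists (L a), (L b), (L c); rewrite -!Ls; split.
- by split => //; exact: L0.
- by split => //; exact: L0.
- by split => //; exact: L0.
- by split => /Li.
Qed.

Lemma split_annihilated_iso : split_annihilated N -> split_annihilated N'.
Proof.
have [L [[L' LK L'K] LD Ls La]] := zpisoP iso.
by move=> H a; rewrite -[a]L'K -Ls -La; exact: H.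
Qed.

Lemma repairable_iso : repairable N -> repairable N'.
Proof.
have [L [[L' LK L'K] LD Ls La]] := zpisoP iso.
move=> [a [b [sa sb ab nb sab]]]; exists (L a), (L b).
rewrite -LD -!Ls -!La; split => //.
by move=> /(can_inj LK).
Qed.

End Transfer.

Section NormalForms.
Variables (k : nat) (k2 : (2 <= k)%N).
Let y0 : 'I_k := Ordinal (ltnW k2).
Let y1 : 'I_k := Ordinal k2.
Let z0 : 'I_2 := ord0.
Let z1 : 'I_2 := ord_max.
Let t0 : 'I_3 := ord0.
Let t1 : 'I_3 := @Ordinal 3 1 isT.
Let t2 : 'I_3 := @Ordinal 3 2 isT.
Let pX : 'I_1 + ('I_k + 'I_2) := inl ord0.
Let pY (y : 'I_k) : 'I_1 + ('I_k + 'I_2) := inr (inl y).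
Let pZ (z : 'I_2) : 'I_1 + ('I_k + 'I_2) := inr (inr z).

Lemma I3P (t : 'I_3) : [\/ t = t0, t = t1 | t = t2].
Proof.
case: t => [[|[|[|//]]] i]; [constructor 1|constructor 2|constructor 3];
  by apply: val_inj.
Qed.

Lemma nf_acyclic (E : 'I_2 -> 'I_2 -> 'F_2) t :
  (forall i j, E i j <> 0 -> (i < j)%N) -> acyclic (nf (k := k) E t).
Proof.
by move=> Elt; rewrite /nf; case: (val t) => [|[|n]]; exact: fam_acyclic.
Qed.

Let diff (a b : 'I_1 + ('I_k + 'I_2) -> 'F_2) s :
  (a s == b s) = false -> a <> b.
Proof. by move=> ab e; rewrite e eqxx in ab. Qed.

Let E0 : 'I_2 -> 'I_2 -> 'F_2 := fun _ _ => 0.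

Let E0_lt i j : E0 i j <> 0 -> (i < j)%N. Proof. by []. Qed.

Let X : 'I_1 + ('I_k + 'I_2) -> 'F_2 := mkf 1 (fun=> 0) (fun=> 0).

(** With torus fibre the sums are 0, X and the two fibre columns. These are y_0 twice in the first
    form, y_0 and X + y_0 in the second, y_0 and y_1 in the third; only the second set is a
    subgroup. *)
Lemma nf_split_closed t : split_closed (nf (k := k) E0 t) <-> t = t1.
Proof.
split; last first.
  move=> ->; pose f s t : 'I_1 + ('I_k + 'I_2) -> 'F_2 :=
    mkf s (fun y => t * (val y == 0%N)%:R) (fun=> 0).
  have S a : split_class (nf (k := k) E0 t1) a <-> exists s t, a = f s t.
    rewrite (split_fam _ _ E0_lt _ y0); split.
      case=> [->|->|[z ->]].
      - by exists 0, 0; apply/funext => -[i|[y|z]] //=; rewrite mul0r.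
      - by exists 1, 0; apply/funext => -[i|[y|z]] //=; rewrite mul0r.
      - exists (val z == 1%N)%:R, 1; apply/funext => -[i|[y|z']] //=.
        by rewrite mul1r.
    move=> [s [t' ->]]; case: (F2P s) => ->; case: (F2P t') => ->.
    - by constructor 1; apply/funext => -[i|[y|z]] //=; rewrite mul0r.
    - by constructor 3; exists z0; apply/funext => -[i|[y|z]] //=;
      rewrite mul1r.
    - by constructor 2; apply/funext => -[i|[y|z]] //=; rewrite mul0r.
    - by constructor 3; exists z1; apply/funext => -[i|[y|z]] //=;
      rewrite mul1r.
  move=> a b /S[s [u ->]] /S[s' [u' ->]]; apply/S; exists (s + s'), (u + u').
  by apply/funext => -[i|[y|z]] //=; rewrite /addf /= ?mulrDl ?addr0.
case: (I3P t) => -> //; rewrite /nf /= => H.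
  have := H X (mkf 0 (fun y => (val y == 0%N)%:R) (fun=> 0)).
  rewrite !(split_fam _ _ E0_lt _ y0).
  case=> [||e|e|[z e]].
  - by constructor 2.
  - by constructor 3; exists z0.
  - by have := congr1 (fun h => h pX) e => /eqP.
  - by have := congr1 (fun h => h (pY y0)) e => /eqP.
  - by have := congr1 (fun h => h pX) e => /eqP.
have := H (mkf 0 (fun y => (val y == 0%N)%:R) (fun=> 0))
          (mkf 0 (fun y => (val y == 1%N)%:R) (fun=> 0)).
rewrite !(split_fam _ _ E0_lt _ y0).
case=> [||e|e|[z e]].
- by constructor 3; exists z0.
- by constructor 3; exists z1.
- by have := congr1 (fun h => h (pY y0)) e => /eqP.
- by have := congr1 (fun h => h (pY y0)) e => /eqP.
- case: (I2P z) e => -> e.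
    by have := congr1 (fun h => h (pY y1)) e => /eqP.
  by have := congr1 (fun h => h (pY y0)) e => /eqP.
Qed.

(** Only in the first form do the two fibre columns coincide, leaving X and y_0 as the nonzero
    sums. *)
Lemma nf_three_split t : three_split (nf (k := k) E0 t) <-> t <> t0.
Proof.
split; last first.
  case: (I3P t) => -> // _; rewrite /nf /=.
    exists X, (mkf 0 (fun y => (val y == 0%N)%:R) (fun=> 0)),
      (mkf 1 (fun y => (val y == 0%N)%:R) (fun=> 0)).
    rewrite !(split_fam _ _ E0_lt _ y0); split.
    - by split; [constructor 2|exact: (diff (s := pX))].
    - by split; [constructor 3; exists z0|exact: (diff (s := pY y0))].
    - by split; [constructor 3; exists z1|exact: (diff (s := pX))].
    - by split;
      [exact: (diff (s := pX))|exact: (diff (s := pY y0))|exact: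
      (diff (s := pX))].
  exists X, (mkf 0 (fun y => (val y == 0%N)%:R) (fun=> 0)),
      (mkf 0 (fun y => (val y == 1%N)%:R) (fun=> 0)).
  rewrite !(split_fam _ _ E0_lt _ y0); split.
  - by split; [constructor 2|exact: (diff (s := pX))].
  - by split; [constructor 3; exists z0|exact: (diff (s := pY y0))].
  - by split; [constructor 3; exists z1|exact: (diff (s := pY y1))].
  - by split;
    [exact: (diff (s := pX))|exact: (diff (s := pX))|exact:
    (diff (s := pY y0))].
move=> H e; move: H; rewrite e /nf /=.
move=> [a [b [c []]]]; rewrite !(split_fam _ _ E0_lt _ y0).
by move=> [[->|->|[z ->]] // _] [[->|->|[z' ->]] // _]
  [[->|->|[z'' ->]] // _] [].
Qed.

Lemma nf_torus_inj t t' :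
  grpiso (nf (k := k) E0 t) (nf (k := k) E0 t') -> t = t'.
Proof.
move=> iso;
  have z := grpiso_zpiso (nf_acyclic _ E0_lt) (nf_acyclic _ E0_lt) iso.
have z' := zpiso_sym z.
have h1 : t = t1 <-> t' = t1.
  by rewrite -!nf_split_closed; split; exact: split_closed_iso.
have h2 : t <> t0 <-> t' <> t0.
  by rewrite -!nf_three_split; split; exact: three_split_iso.
case: (I3P t) h1 h2 => ->; case: (I3P t') => -> // h1 h2.
- by case: (h2.2 _ erefl).
- by case: (h2.2 _ erefl).
- by have := h1.1 erefl.
- by have := h1.1 erefl.
- by case: (h2.1 _ erefl).
- by have := h1.2 erefl.
Qed.

Let kleinN_lt i j : kleinN i j <> 0 -> (i < j)%N.
Proof. by rewrite /kleinN; case: (i < j)%N. Qed.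

Let nfK t := nf (k := k) kleinN t.
Let acK t : acyclic (nfK t). Proof. exact: nf_acyclic. Qed.

Let ann0 t : annihilated (nfK t) (@zerof _).
Proof.
apply: (@annihilated_inh _ _ _ (fun=> 1) pX); first exact: F2_1_neq0.
by move=> i j _; rewrite /zerof !(mul0r, mulr0) addr0.
Qed.

Let annX t : annihilated (nfK t) X.
Proof.
have -> : X = (fun i => (i == pX)%:R) by apply/funext => -[i|[y|z]] //;
  rewrite (ord1 i).
exact: ann_unit.
Qed.

Let annY t (y : 'I_k) :
  annihilated (nfK t) (mkf 0 (fun y' => (val y' == val y)%:R) (fun=> 0)).
Proof.
have -> : mkf 0 (fun y' => (val y' == val y)%:R) (fun=> 0)
  = (fun i => (i == pY y)%:R).
  by apply/funext => -[i|[y'|z]].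
exact: ann_unit.
Qed.

(** When z_0 is the leading coordinate of u, [zp_lead] leaves a single candidate for a nonzero v
    with u v = 0; refuting it shows that u is not a zero divisor. *)
Let lead_z0 t u v : zp (nfK t) u v -> v <> @zerof _ ->
  u (pZ z0) = 1 -> u (pZ z1) = 0 -> v = fun s => u s + nfK t s (pZ z0).
Proof.
move=> uv v0 uz0 uz1.
have u0 : u <> @zerof _ by apply: (diff (s := pZ z0)); rewrite uz0.
have [d [C nfE]] : exists d C, nfK t = fam d C kleinN.
  rewrite /nfK /nf; case: (val t) => [|[|n]]; by do 2 eexists.
have [j [uj vj uvj ubig]] := zp_lead (@fam_rank_inj k 2)
  (fun i j => @fam_rank_lt k 2 d C kleinN kleinN_lt i j)
  (eq_ind _ (fun N => zp N u v) uv _ nfE) u0 v0.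
have jE : j = pZ z0.
  case: j uj {vj uvj} ubig => [i|[y|z]] uj ubig.
  - by have := ubig (pZ z0) isT; rewrite uz0 => /eqP; rewrite oner_eq0.
  - have := ubig (pZ z0); rewrite uz0 /= => H.
    have := H _; have -> : (y.+1 < k.+1 + z0)%N by rewrite /= addn0 ltnS.
    by move/(_ isT)/eqP; rewrite oner_eq0.
  - case: (I2P z) uj => -> //; rewrite uz1 => /eqP.
    by rewrite eq_sym oner_eq0.
apply/funext => s; rewrite nfE -jE -uvj addrA F2D add0r //.
Qed.

(** The sum to examine is the column of z_1. It is y_0 + z_0 in the first form, killed by z_0; in
    the other forms it is X + y_0 + z_0 or y_1 + z_0, and the only candidate violates the equation
    at (X, y_0) or at (y_0, y_1). *)
Lemma nf_split_annihilated t : split_annihilated (nfK t) <-> t = t0.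
Proof.
split; last first.
  move=> -> a; rewrite (split_fam _ _ kleinN_lt _ y0) => -[->|->|[z ->]].
  - exact: ann0.
  - exact: annX.
  - case: (I2P z) => ->.
      have -> : kleinN^~ ord0 = fun=> 0 by apply/funext => z';
        case: (I2P z') => ->.
      exact: (annY t0 y0).
    have -> : mkf 0 (@nf_equal k ^~ z1) (kleinN^~ z1) =
        (fun i => (i == pZ z0)%:R + nfK t0 i (pZ z0)).
      apply/funext => -[i|[y|z']] //=; rewrite ?add0r // ?addr0.
      by case: (I2P z') => ->.
    exact: ann_unit_col.
case: (I3P t) => -> // H.
  have [|v v0 av] := H (mkf 1 (@nf_equal k ^~ z1) (kleinN^~ z1)).
    by rewrite (split_fam _ _ kleinN_lt _ y0); constructor 3; exists z1.
  have vE := lead_z0 av v0 erefl erefl.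
  by have := av pX (pY y0) isT; rewrite vE => /eqP.
have [|v v0 av] := H (mkf 0 (@nf_indep k ^~ z1) (kleinN^~ z1)).
  by rewrite (split_fam _ _ kleinN_lt _ y0); constructor 3; exists z1.
have vE := lead_z0 av v0 erefl erefl.
by have := av (pY y0) (pY y1) isT; rewrite vE => /eqP.
Qed.

(** In the third form b must be y_1 + z_0 and a one of 0, X, y_0; the equation at (y_0, y_1) fails
    for a + b in each case. In the first form there is no b. *)
Lemma nf_repairable t : repairable (nfK t) <-> t = t1.
Proof.
split; last first.
  move=> ->; exists X, (mkf 1 (@nf_equal k ^~ z1) (kleinN^~ z1)).
  rewrite !(split_fam _ _ kleinN_lt _ y0); split.
  - by constructor 2.
  - by constructor 3; exists z1.
  - exact: (diff (s := pY y0)).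
  - move=> [v v0 av]; have vE := lead_z0 av v0 erefl erefl.
    by have := av pX (pY y0) isT; rewrite vE => /eqP.
  - have -> : addf X (mkf 1 (@nf_equal k ^~ z1) (kleinN^~ z1)) =
        (fun i => (i == pZ z0)%:R + nfK t1 i (pZ z0)).
      apply/funext => -[i|[y|z']]; rewrite /addf //=; first by apply/eqP.
      by case: (I2P z') => ->; apply/eqP.
    exact: ann_unit_col.
case: (I3P t) => -> // -[a [b [sa sb ab nb sab]]].
  by case: nb; exact: (nf_split_annihilated t0).2.
have bE : b = mkf 0 (@nf_indep k ^~ z1) (kleinN^~ z1).
  move: sb; rewrite (split_fam _ _ kleinN_lt _ y0) => -[e|e|[z e]].
  - by case: nb; rewrite e; exact: ann0.
  - by case: nb; rewrite e; exact: annX.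
  - case: (I2P z) e => -> e //.
    case: nb; rewrite e.
    have -> : kleinN^~ ord0 = fun=> 0 by apply/funext => z';
      case: (I2P z') => ->.
    exact: (annY t2 y0).
have aE : exists s u, a = mkf s (fun y => u * (val y == 0%N)%:R) (fun=> 0).
  move: sa; rewrite (split_fam _ _ kleinN_lt _ y0) => -[->|->|[z e]].
  - by exists 0, 0; apply/funext => -[i|[y|z]] //=; rewrite mul0r.
  - by exists 1, 0; apply/funext => -[i|[y|z]] //=; rewrite mul0r.
  - case: (I2P z) e => -> e; last by case: ab; rewrite e bE.
    exists 0, 1; rewrite e; apply/funext => -[i|[y|z']] /=;
      [by []|by rewrite mul1r|].
    by case: (I2P z') => ->.
have [s [u {}aE]] := aE; have [v v0 av] := sab.
have vE : v = (fun s => addf a b s + nfK t2 s (pZ z0)).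
  by apply: lead_z0 av v0 _ _; rewrite aE bE /addf /= ?addr0 ?add0r.
have := av (pY y0) (pY y1) isT; rewrite vE aE bE /addf /=.
by case: (F2P u) => -> /eqP.
Qed.

Lemma nf_klein_inj t t' : grpiso (nfK t) (nfK t') -> t = t'.
Proof.
move=> iso; have z := grpiso_zpiso (acK t) (acK t') iso.
have z' := zpiso_sym z.
have h1 : t = t0 <-> t' = t0.
  by rewrite -!nf_split_annihilated; split; exact: split_annihilated_iso.
have h2 : t = t1 <-> t' = t1.
  by rewrite -!nf_repairable; split; exact: repairable_iso.
case: (I3P t) h1 h2 => ->; case: (I3P t') => -> // h1 h2.
- by have := h1.1 erefl.
- by have := h1.1 erefl.
- by have := h1.2 erefl.
- by have := h2.1 erefl.
- by have := h1.2 erefl.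
- by have := h2.2 erefl.
Qed.

End NormalForms.

(** * Counting *)

(** Read [h A c] as: c labels a normal form of A. The class of A is then the set [K c] attached to
    its label, and [K] is injective, so classes are counted by labels. *)
Lemma num_diffeo_classesE (R : realType) n m (P : 'M['F_2]_n -> Prop)
    (h : 'M['F_2]_n -> 'I_m -> Prop) :
  (forall A, P A -> exists c, h A c) ->
  (forall A B c, h A c -> h B c -> diffeomorphic R A B) ->
  (forall A B c c', h A c -> h B c' -> diffeomorphic R A B -> c = c') ->
  (forall c, exists A, P A /\ h A c) ->
  num_diffeo_classes R P = m.
Proof.
move=> hP hdiff hinj hsurj; rewrite /num_diffeo_classes.
set D := finset _; set r := fun A B => _.
have DE A : (A \in D) = `[< P A >] by rewrite finset.in_set.
have [rep repP] := choice hsurj.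
pose K c := finset (fun B => (B \in D) && r (rep c) B).
have KE A c : h A c -> finset (fun B => (B \in D) && r A B) = K c.
  move=> hA; apply/setP => B; rewrite !finset.in_set;
    apply: andb_id2l => /asboolP BP.
  have [c' hB] := hP _ BP; have [_ hr] := repP c.
  apply: asbool_equiv_eq; split=> /hinj dd.
    by rewrite (dd _ _ hA hB) in hr *; exact: (hdiff _ _ _ hr hB).
  by rewrite (dd _ _ hr hB) in hA; exact: (hdiff _ _ _ hA hB).
have -> : equivalence_partition r D = K @: [set: 'I_m]%SET.
  apply/setP => S; apply/imsetP/imsetP => [[A]|[c _ ->]].
    rewrite DE => /asboolP PA ->; have [c hA] := hP _ PA.
    by exists c; rewrite ?finset.in_setT //; exact: KE.
  exists (rep c); first by rewrite DE; apply/asboolP; case: (repP c).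
  by apply/esym/KE; case: (repP c).
rewrite card_imset ?cardsT ?card_ord // => c c' KK.
have [Pc hrc] := repP c; have [_ hrc'] := repP c'.
have : rep c \in K c.
  rewrite !finset.in_set; apply/andP; split; first exact/asboolP.
  by apply/asboolP; exact: (hdiff _ _ _ hrc hrc).
rewrite KK finset.in_set => /andP[_ /asboolP dd].
by rewrite (hinj _ _ _ _ hrc' hrc dd).
Qed.

(** * Normal forms for the fibre T^t over a two-dimensional base *)

Section Bundle.
Variables (t m : nat).

Definition nf_line : 'I_1 + ('I_1 + 'I_t) -> 'I_1 + ('I_1 + 'I_t) -> 'F_2 :=
  fam (fun z => (val z < m)%N%:R) (fun _ _ => 1) (fun _ _ => 0).

Let E_lt (i j : 'I_t) : (0 : 'F_2) <> 0 -> (i < j)%N. Proof. by []. Qed.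

Lemma nf_line_acyclic : acyclic nf_line.
Proof. exact: fam_acyclic. Qed.

Let pX : 'I_1 + ('I_1 + 'I_t) := inl ord0.
Let pY : 'I_1 + ('I_1 + 'I_t) := inr (inl ord0).
Let pZ (z : 'I_t) : 'I_1 + ('I_1 + 'I_t) := inr (inr z).

Lemma zp_nf_line u v : zp nf_line u v <->
  [/\ u pX * v pY + u pY * v pX = u pY * v pY,
      forall z, u pX * v (pZ z) + u (pZ z) * v pX = (val z < m)%N%:R *
        (u (pZ z) * v (pZ z)),
      forall z, u pY * v (pZ z) + u (pZ z) * v pY = u (pZ z) * v (pZ z) &
      forall z z', z != z' -> u (pZ z) * v (pZ z') + u (pZ z') * v (pZ z) = 0].
Proof.
split=> [uv|[h1 h2 h3 h4]].
  split=> [|z|z|z z' zz'].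
  - by rewrite uv //= mul0r mul1r addr0.
  - by rewrite uv //= mul0r addr0.
  - by rewrite uv //= mul0r mul1r addr0.
  - by rewrite uv //= ?mul0r ?addr0 // (inj_eq (@inr_inj _ _)).
move=> [i|[i|z]] [j|[j|z']]; rewrite ?(ord1 i) ?(ord1 j) //= => ij.
- by rewrite h1 mul0r mul1r addr0.
- by rewrite h2 mul0r addr0.
- by rewrite addrC h1 mul0r mul1r add0r.
- by rewrite h3 mul0r mul1r addr0.
- by rewrite addrC h2 mul0r add0r.
- by rewrite addrC h3 mul0r mul1r add0r.
- by rewrite h4 ?mul0r ?addr0.
Qed.

Definition box (bx by' : bool) (q : pred 'I_t) : pred ('I_1 + ('I_1 + 'I_t)) :=
  fun s => match s with inl _ => bx | inr (inl _) => by' | inr (inr z)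
    => q z end.

Lemma card_box bx by' q : #|box bx by' q| = (bx + by' + #|q|)%N.
Proof.
rewrite -!sum1_card [LHS]big_mkcond /= big_sumType /= big_ord1 big_sumType
  /= big_ord1.
rewrite -addnA; congr (_ + (_ + _))%N.
by rewrite -big_mkcond.
Qed.

Lemma card_boxed bx by' q :
  #|pffun_on (0 : 'F_2) (box bx by' q) predT| = (2 ^ (bx + by' + #|q|))%N.
Proof. by rewrite card_pffun_on card_box -[#|predT|]/#|'F_2| card_ord. Qed.

Lemma boxedP bx by' q (u : {ffun 'I_1 + ('I_1 + 'I_t) -> 'F_2}) :
  reflect (forall s, ~~ box bx by' q s -> u s = 0)
    (u \in pffun_on (0 : 'F_2) (box bx by' q) predT).
Proof.
apply: (iffP pfamilyP) => [[/fintype.subsetP us _] s|us].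
  by apply: contraNeq => /us.
split=> //; apply/fintype.subsetP => s su; apply: contraT => /us e.
by move: su; rewrite unfold_in /= e eqxx.
Qed.

Lemma card_below : (m <= t)%N -> #|[pred z : 'I_t | val z < m]%N| = m.
Proof.
move=> mt; rewrite -sum1_card (eq_bigl (fun z : 'I_t => (z < m)%N)) //.
by rewrite -(big_ord_widen _ (fun=> 1%N)) // sum1_card card_ord.
Qed.

Lemma card_above : (m <= t)%N -> #|[pred z : 'I_t | ~~ (val z < m)%N]|
  = (t - m)%N.
Proof.
move=> mt; have := cardC [pred z : 'I_t | val z < m]%N.
rewrite card_below // card_ord => e; apply/eqP;
  rewrite -(eqn_add2l m) subnKC //.
by rewrite -[X in _ == X]e; apply/eqP; congr (_ + _)%N; exact: eq_card.
Qed.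

Hypothesis mt : (m <= t./2)%N.

Let mt' : (m <= t)%N. Proof. by lia. Qed.

(** For b = y and z >= m the relation of the coordinate z reads z^2 = y z. Squaring is additive
    modulo 2, so y and these z span a space of solutions. *)
Lemma eigen_nf_line_lower :
  exists b, (2 ^ (1 + (t - m)) <= #|eigen nf_line b|)%N.
Proof.
exists (mkf 0 (fun=> 1) (fun=> 0)).
rewrite -(card_above mt') -(card_boxed false true); apply/subset_leq_card.
apply/fintype.subsetP => u /boxedP us; apply/eigenP/zp_nf_line.
have ux : u pX = 0 by rewrite us.
have uz z : (val z < m)%N -> u (pZ z) = 0 by move=> zm; rewrite us //= zm.
rewrite /addf /= ux !mul0r !add0r; split.
- by rewrite mulr0; case: (F2P (u pY)) => ->; rewrite ?mul0r // F2D mulr0.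
- move=> z; rewrite mulr0 !addr0; case zm: (val z < m)%N.
    by rewrite uz // !mulr0.
  by rewrite mulr0n !mul0r.
- move=> z; rewrite !addr0 mulrDr mulr1 [u pY * _]mulrC addrA F2D add0r.
  by rewrite F2_mulK.
- by move=> z z' _; rewrite !addr0 [u (pZ z') * _]mulrC F2D.
Qed.

Hypothesis t2 : (2 <= t)%N.

(** A solution u other than 0 and b exhibits b as the sum of u and u + b, so b is 0, X, y or X + y.
    In the first two cases solutions involve only X and y. For b = y + s X they satisfy u_X = s u_y
    and vanish at z unless (z < m) = s; this leaves at most 1 + max(m, t - m) dimensions, and m <= t
    / 2. *)
Lemma eigen_nf_line_upper b : (#|eigen nf_line b| <= 2 ^ (1 + (t - m)))%N.
Proof.
have le4 n : (n <= 2 -> 2 ^ n <= 2 ^ (1 + (t - m)))%N.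
  by move=> n2; rewrite leq_exp2l //; lia.
have [[u [ue u0 ub]]|triv] := pselect (exists u : {ffun _ -> 'F_2},
  [/\ u \in eigen nf_line b, (u : _ -> _) <> @zerof _ & (u : _ -> _) <> b]);
    last first.
  apply: leq_trans (le4 1%N isT).
  have sub : eigen nf_line b \subset [set finfun (@zerof _); finfun b]%SET.
    apply/fintype.subsetP => u ue; rewrite !finset.inE; apply/orP.
    have [e|ne] := pselect ((u : _ -> 'F_2) = @zerof _).
      by left; apply/eqP/ffunP => s; rewrite ffunE e.
    right; apply/eqP/ffunP => s; rewrite ffunE.
    suff -> : (u : _ -> 'F_2) = b by [].
    by apply: contrapT => nb; apply: triv; exists u.
  apply: leq_trans (subset_leq_card sub) _.
  by rewrite cards2; case: (_ != _).
have : split_class nf_line b.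
  exists u, (addf u b); split => //.
  - move=> e; apply: ub; apply/funext => s.
    have := congr1 (fun h => h s) e; rewrite /addf /zerof => /eqP.
    by rewrite addr_eq0 F2N => /eqP.
  - exact/eigenP.
  - by apply/funext => s; rewrite /addf addrA F2D add0r.
rewrite (split_fam _ _ E_lt _ ord0) => bE.
have {bE} [[s bE]|[s bE]] : (exists s, b = mkf s (fun=> 0) (fun=> 0)) \/
    (exists s : bool, b = mkf s%:R (fun=> 1) (fun=> 0)).
  case: bE => [->|->|[z ->]].
  - by left; exists 0; apply/funext => -[i|[y|z]].
  - by left; exists 1.
  - by right; exists (val z < m)%N.
- apply: leq_trans (le4 2%N isT).
  have -> : (2 ^ 2 = 2 ^ (true + true + #|pred0 : pred 'I_t|))%N
    by rewrite card0.
  rewrite -card_boxed; apply/subset_leq_card/fintype.subsetP => w.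
  move=> /eigenP/zp_nf_line; rewrite bE /addf /= !addr0 => -[_ _ wz _].
  apply/boxedP => -[i|[y|z]] //= _.
  by have := wz z; rewrite addr0 [u in u + _]mulrC F2D F2_mulK.
(* The X coordinate of a solution is determined by its y coordinate, so forgetting it is
   injective. *)
pose F (w : {ffun 'I_1 + ('I_1 + 'I_t) -> 'F_2}) :
  {ffun 'I_1 + ('I_1 + 'I_t) -> 'F_2} :=
  [ffun p => match p with inl _ => 0 | _ => w p end].
have wP (w : {ffun 'I_1 + ('I_1 + 'I_t) -> 'F_2}) : w \in eigen nf_line b ->
    w pX = s%:R * w pY /\ forall z, (val z < m)%N != s -> w (pZ z) = 0.
  move=> /eigenP/zp_nf_line; rewrite bE /addf /= => -[h1 h2 _ _]; split.
    move: h1; case: (F2P (w pX)) => ->; case: (F2P (w pY)) => ->;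
      by case: s {bE h2} => h; apply/eqP => //; move/eqP: h.
  move=> z; have {h1 h2} := h2 z; case: (F2P (w pX)) => ->;
    case: (F2P (w (pZ z))) => -> //;
    by case: s {bE}; case: (val z < m)%N => // /eqP.
have Finj : {in eigen nf_line b &, injective F}.
  move=> w w' /wP[wx _] /wP[wx' _] /ffunP e; apply/ffunP => -[i|p].
    rewrite (ord1 i) wx wx'; congr (_ * _).
    by have := e pY; rewrite !ffunE.
  by have := e (inr p); rewrite !ffunE.
rewrite -(card_in_imset Finj).
pose q : pred 'I_t := fun z => (val z < m)%N == s.
apply: (@leq_trans (2 ^ (false + true + #|q|))%N); last first.
  rewrite leq_exp2l // add0n leq_add2l /q; case: s {bE wP q}.
    rewrite (eq_card (B := [pred z : 'I_t | val z < m]%N)) => [|z].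
      by rewrite card_below //; lia.
    by rewrite !unfold_in /=; case: (_ < _)%N.
  rewrite (eq_card (B := [pred z : 'I_t | ~~ (val z < m)%N])) => [|z].
    by rewrite card_above.
  by rewrite !unfold_in /=; case: (_ < _)%N.
rewrite -card_boxed; apply/subset_leq_card/fintype.subsetP =>
  w' /imsetP[w /wP[_ wz] ->].
apply/boxedP => -[i|[y|z]] //= qz; rewrite ffunE //.
exact: wz.
Qed.

End Bundle.

Arguments nf_line : clear implicits.

Lemma nf_line_inj t m m' : (2 <= t)%N -> (m <= t./2)%N -> (m' <= t./2)%N ->
  grpiso (nf_line t m) (nf_line t m') -> m = m'.
Proof.
move=> t2.
suff H a b : (a <= t./2)%N -> (b <= t./2)%N ->
    grpiso (nf_line t a) (nf_line t b) -> (b <= a)%N.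
  move=> mt mt' iso; apply/eqP; rewrite eqn_leq.
  by rewrite (H _ _ mt mt' iso) (H _ _ mt' mt (grpiso_sym iso)).
move=> ha hb iso.
have z := grpiso_zpiso (nf_line_acyclic _ _) (nf_line_acyclic _ _) iso.
have [c cP] := eigen_nf_line_lower ha; have [c' c'P] := zpiso_eigen z c.
have := leq_trans cP (leq_trans c'P (eigen_nf_line_upper hb t2 c')).
by rewrite leq_exp2l //; lia.
Qed.

Lemma perm_count t (p q : pred 'I_t) : #|p| = #|q| -> exists s : 'S_t, forall z,
  p (s z) = q z.
Proof.
move=> pq; pose f (r : pred 'I_t) := [tuple r z | z < t].
have cnt r : count_mem true (f r) = #|r|.
  rewrite count_map cardE /enum_mem size_filter -enumT.
  by apply: eq_count => z /=; rewrite eqb_id.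
have /tuple_permP[s sE] : perm_eq (f q) (f p).
  have szt r : size (f r) = t by rewrite size_tuple.
  have cnf r : count_mem false (f r) = (t - #|r|)%N.
    have := count_predC (pred1 true) (f r); rewrite cnt szt => e.
    rewrite (eq_count (a2 := predC (pred1 true))) => [|[]] //.
    by apply/eqP;
      rewrite -(eqn_add2l #|r|) e subnKC // -[X in (_ <= X)%N]card_ord max_card.
  by apply/allP => -[] _ /=; rewrite ?cnt ?cnf pq.
exists s => z; have := congr1 (fun w => tnth w z) (val_inj sE).
by rewrite !tnth_mktuple => ->.
Qed.

(** Translating the coordinate of S^1 by pi / 2 adds 1 to every entry of d, replacing the number m
    of ones by t - m. So m may be taken at most t / 2, whence the [t/2] + 1 labels. *)
Lemma fam_line (R : realType) t (d : 'I_t -> 'F_2) :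
  exists m : 'I_(t./2 + 1),
    affequiv R (fam d (fun _ : 'I_1 => fun _ => 1) (fun _ _ => 0))
    (nf_line t m).
Proof.
have sorted (d' : 'I_t -> 'F_2) : (#|[pred z | d' z == 1%R]| <= t./2)%N ->
    affequiv R (fam d' (fun _ : 'I_1 => fun _ => 1) (fun _ _ => 0))
      (nf_line t #|[pred z | d' z == 1%R]|).
  set m := #|_| => mt.
  have [|s sP] := @perm_count t [pred z | d' z == 1%R] [pred z | val z < m]%N.
    by rewrite card_below //; lia.
  have step := fam_reindex R d' (fun _ : 'I_1 => fun _ => 1) (fun _ _ => 0)
    (@id_bij 'I_1) (perm_bij s).
  apply: affequiv_trans step _; apply: fam_eq => // z.
  by have := sP z; rewrite /= => <-; case: (F2P (d' (s z))) => ->.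
have [small|big] := leqP #|[pred z | d z == 1%R]| t./2.
  have mt : (#|[pred z | d z == 1%R]| < t./2 + 1)%N by lia.
  by exists (Ordinal mt); exact: sorted.
have flip : #|[pred z | (d z + 1)%R == 1%R]| = (t - #|[pred z | d z == 1%R]|)%N.
  have := cardC [pred z | d z == 1%R]; rewrite card_ord => e; apply/eqP.
  rewrite -(eqn_add2l #|[pred z | d z == 1%R]|) subnKC;
    last by rewrite -[X in (_ <= X)%N]e leq_addr.
  rewrite -[X in _ == X]e; apply/eqP; congr (_ + _)%N.
  by apply: eq_card => z; rewrite !inE; case: (F2P (d z)) => ->.
have small : (#|[pred z | (d z + 1)%R == 1%R]| <= t./2)%N by rewrite flip; lia.
have mt : (#|[pred z | (d z + 1)%R == 1%R]| < t./2 + 1)%N by lia.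
exists (Ordinal mt); apply: affequiv_trans (sorted _ small).
exact: (fam_shift R d (fun _ : 'I_1 => fun _ => 1) (fun _ _ => 0) ord0).
Qed.

(** * The counts of diffeomorphism classes *)

Section Classification.
Variable R : realType.

Lemma rank_12 k (C : 'M['F_2]_(k, 2)) y z : C y z <> 0 ->
  \rank C = 1%N \/ \rank C = 2%N.
Proof.
move=> Cyz; have := rank_leq_col C; have : (0 < \rank C)%N.
  by rewrite lt0n mxrank_eq0; apply/eqP => C0; apply: Cyz; rewrite C0 mxE.
lia.
Qed.

(** Common to the two fibres of (i). Every normal form is realised because its C has nonzero
    columns; its rank, with two columns available, is then 1 or 2. *)
Lemma num_fiber_classes k (X' : 'M['F_2]_2 -> Prop) (E : 'I_2 -> 'I_2 ->
  'F_2) B0 :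
  (2 <= k)%N ->
  (forall B, X' B -> bottN B = E) ->
  bott_matrix B0 -> X' B0 ->
  (forall d (C : 'I_k -> 'I_2 -> 'F_2),
    (forall z, (exists y, C y z <> 0) \/ (exists z', E z' z <> 0)) ->
    exists t, affequiv R (fam d C E) (nf (k := k) E t)) ->
  (forall t t', grpiso (nf (k := k) E t) (nf (k := k) E t') -> t = t') ->
  num_diffeo_classes R
    (twisted_product (k := 1) 1 (m := k + 2)
      (fun B => exists s : nat, (s = 1%N \/ s = 2%N) /\
         twisted_product (k := k) s (m := 2) X' B)) = 3%N.
Proof.
move=> k2 XE bB0 XB0 cls inj.
apply: (num_diffeo_classesE
  (h := fun A (t : 'I_3) => affequiv R (bottN A) (nf (k := k) E t))).
- move=> A tA; have [|bA [d [C [B [bB XB AF colC]]]]] :=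
  nested_elim (X' := X') R _ tA.
    by move=> B [s [_ tB]]; exists s.
  rewrite (XE B XB) in AF colC.
  have [t tP] := cls d C colC; exists t; exact: affequiv_trans AF tP.
- move=> A B t At Bt; apply: affequiv_diffeo.
  exact: affequiv_trans At (affequiv_sym Bt).
- move=> A B t t' At Bt' /diffeo_grpiso AB; apply: inj.
  exact: grpiso_trans (grpiso_sym (affequiv_grpiso At))
    (grpiso_trans AB (affequiv_grpiso Bt')).
- have real d (C : 'M['F_2]_(k, 2)) : (forall z, exists y, C y z <> 0) ->
      exists A, twisted_product (k := 1) 1 (m := k + 2)
        (fun B => exists s : nat, (s = 1%N \/ s = 2%N) /\
         twisted_product (k := k) s (m := 2) X' B) A /\
        affequiv R (bottN A) (fam d (fun y z => C y z) E).
    move=> colC; have [|||A [tA [_ AF]]] :=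
      nested_intro (s' := \rank C) (C := C) R
      (X := (fun B => exists s : nat, (s = 1%N \/ s = 2%N) /\
         twisted_product (k := k) s (m := 2) X' B)) d _ _ bB0 XB0 erefl.
    + by lia.
    + move=> B tB; exists (\rank C); split => //.
      by have [y Cy] := colC ord0; exact: rank_12 Cy.
    + by move=> z; left.
    + by exists A; split => //; rewrite -(XE _ XB0).
  have real' d (C : 'I_k -> 'I_2 -> 'F_2) : (forall z, exists y, C y z <> 0) ->
      exists A, twisted_product (k := 1) 1 (m := k + 2)
        (fun B => exists s : nat, (s = 1%N \/ s = 2%N) /\
         twisted_product (k := k) s (m := 2) X' B) A /\
        affequiv R (bottN A) (fam d C E).
    move=> colC; have [|A [tA AF]] := real d (\matrix_(y, z) C y z).
      by move=> z; have [y] := colC z; exists y; rewrite mxE.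
    exists A; split => //; apply: affequiv_trans AF _.
    by apply: fam_eq => // y z; rewrite mxE.
  have k0 : (0 < k)%N by lia.
  move=> t; rewrite /nf; case: (val t) => [|[|_]]; apply: real' => z.
  + by exists (Ordinal k0); apply/eqP; rewrite /nf_equal oner_eq0.
  + by exists (Ordinal k0); apply/eqP; rewrite /nf_equal oner_eq0.
  + exists (widen_ord k2 z); rewrite /nf_indep /= eqxx; apply/eqP.
    by rewrite oner_eq0.
Qed.

Lemma torus_classes k : (2 <= k)%N ->
  num_diffeo_classes R
    (twisted_product (k := 1) 1 (m := k + 2)
      (fun B => exists s : nat, (s = 1%N \/ s = 2%N) /\
         twisted_product (k := k) s (m := 2) (@is_torus R 2) B)) = 3%N.
Proof.
move=> k2; apply: (@num_fiber_classes _ _ (fun _ _ => 0) 1%:M) => //.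
- by move=> B /is_torus_bottN.
- exact: bott_matrix1.
- exact: is_torus1.
- move=> d C colC.
  have colC' z : exists y, C y z <> 0 by case: (colC z) => // -[].
  have [CC|nCC] := pselect (forall y, C y ord_max = C y ord0).
    exact: fam_equal.
  exists (@Ordinal 3 2 isT); apply: fam_indep => //.
  by apply: contrapT => h; apply: nCC => y; apply: contrapT => ny; apply: h;
    exists y.
- by move=> t t'; exact: nf_torus_inj.
Qed.

Lemma klein_classes k : (2 <= k)%N ->
  num_diffeo_classes R
    (twisted_product (k := 1) 1 (m := k + 2)
      (fun B => exists s : nat, (s = 1%N \/ s = 2%N) /\
         twisted_product (k := k) s (m := 2) (@is_klein_bottle R) B)) = 3%N.
Proof.
move=> k2; apply: (@num_fiber_classes _ _ kleinN klein_mx) => //.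
- by move=> B /is_klein_bottle_bottN.
- by case: (is_klein_bottle_klein R).
- exact: is_klein_bottle_klein.
- move=> d C colC.
  have col0 : exists y, C y ord0 <> 0.
    by case: (colC ord0) => // -[z']; rewrite /kleinN ltn0.
  have [CC|nCC] := pselect (forall y, C y ord_max = C y ord0).
    exact: fam_equal.
  have [C0|nC0] := pselect (forall y, C y ord_max = 0).
    (* Unlike for the torus, the second column of C may vanish here. Translating the first fibre
       coordinate by pi / 2 copies the first column onto it, which leads back to equal columns. *)
    have step := @fam_shift_last R _ _ d C kleinN ord0 erefl.
    have [||t tP] := @fam_equal R k k2 (fun z => d z + d ord0 * kleinN ord0 z)
      (fun y z => C y z + C y ord0 * kleinN ord0 z) kleinN.
    + by have [y Cy] := col0; exists y; rewrite /kleinN mulr0 addr0.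
    + by move=> y; rewrite C0 /kleinN /= mulr1 mulr0 add0r addr0.
    exists t; apply: affequiv_trans step (affequiv_trans _ tP).
    apply: fam_eq => // z' z; case: (I2P z') => ->; case: (I2P z) => ->;
      by apply/eqP.
  have w (l l' : 'I_k -> 'F_2) : ~ (forall y, l y = l' y) ->
    exists y, l y <> l' y.
    by move=> n; apply: contrapT => h; apply: n => y; apply: contrapT => ny;
      apply: h; exists y.
  exists (@Ordinal 3 2 isT); apply: fam_indep => //; exact: w.
- by move=> t t'; exact: nf_klein_inj.
Qed.

Lemma line_classes t : (2 <= t)%N ->
  num_diffeo_classes R
    (twisted_product (k := 1) 1 (m := 1 + t)
       (fun B => twisted_product (k := 1) 1 (m := t) (@is_torus R t) B))
  = (t./2 + 1)%N.
Proof.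
move=> t2.
apply: (num_diffeo_classesE (h := fun A (m : 'I_(t./2 + 1)) =>
  affequiv R (bottN A) (nf_line t m))).
- move=> A tA; have [|bA [d [C [B [bB XB AF colC]]]]] :=
  nested_elim (X' := @is_torus R t) R _ tA.
    by move=> B tB; exists 1%N.
  rewrite (is_torus_bottN XB) in AF colC.
  have [m mP] := fam_line R d; exists m;
    apply: affequiv_trans AF (affequiv_trans _ mP).
  apply: fam_eq => // y z; case: (colC z) => [[y']|[]//].
  by rewrite (ord1 y) (ord1 y') => /F2_neq0.
- move=> A B m Am Bm; apply: affequiv_diffeo.
  exact: affequiv_trans Am (affequiv_sym Bm).
- move=> A B m m' Am Bm' /diffeo_grpiso AB; apply: ord_inj.
  have le (c : 'I_(t./2 + 1)) : (c <= t./2)%N by case: c => c /=;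
    rewrite addn1 ltnS.
  apply: (nf_line_inj t2); [exact: le|exact: le|].
  exact: grpiso_trans (grpiso_sym (affequiv_grpiso Am))
    (grpiso_trans AB (affequiv_grpiso Bm')).
- move=> m; have t0 : (0 < t)%N by lia.
  have rC : \rank (const_mx 1 : 'M['F_2]_(1, t)) = 1%N.
    by apply: (mxrank_rV_neq0 (j := Ordinal t0)); rewrite mxE; exact: F2_1_neq0.
  have [|||A [tA [_ AF]]] :=
    nested_intro (X := twisted_product (k := 1) 1 (m := t) (@is_torus R t))
    R (fun z : 'I_t => (val z < m)%N%:R) _ _ (bott_matrix1 t)
      (is_torus1 R t) rC.
  + by [].
  + by [].
  + by move=> z; left; exists ord0; rewrite mxE; exact: F2_1_neq0.
  + exists A; split => //; rewrite bottN1 in AF; apply: affequiv_trans AF _.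
    by apply: fam_eq => // y z; rewrite mxE.
Qed.

(** A matrix of rank one is a product of a column u and a row v; as no column of C vanishes, every
    entry of v is 1. *)
Lemma rank1_columns k m (C : 'M['F_2]_(k, m)) : \rank C = 1%N ->
  (forall z, exists y, C y z <> 0) -> forall y z z', C y z = C y z'.
Proof.
move=> rC colC.
have CE y z : C y z = \sum_(a < \rank C) col_base C y a * row_base C a z.
  by rewrite -{1}(mulmx_base C) mxE.
move: (col_base C) (row_base C) CE; rewrite rC => u v CE.
have {}CE y z : C y z = u y 0 * v 0 z by rewrite CE big_ord1.
have v1 z : v 0 z = 1.
  by have [y Cy] := colC z; apply: F2_neq0 => v0; apply: Cy;
    rewrite CE v0 mulr0.
by move=> y z z'; rewrite !CE !v1.
Qed.

(** The columns of C are all equal and the base coordinates are never conjugated, so one pivot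
    leaves a single nonzero row, consisting of ones; it remains to move it to the front. *)
Lemma bundle_class k m : (1 <= k)%N -> (1 <= m)%N ->
  num_diffeo_classes R (twisted_product (k := k) 1 (m := m) (@is_torus R m))
    = 1%N.
Proof.
move=> k0 m0; pose y0 := Ordinal k0.
pose N0 := glue (fun (y : 'I_k) (z : 'I_m) => (y == y0)%:R) (fun _ _ => 0).
apply: (num_diffeo_classesE (h := fun A (c : 'I_1) => affequiv R (bottN A) N0)).
- move=> A /twisted_product_elim[bA [C [B [[bB XB] rC [g gb gE] colC]]]].
  exists ord0; apply: affequiv_trans (affequiv_reindex R gb gE) _.
  rewrite (is_torus_bottN XB) in colC *.
  have colC' z : exists y, C y z <> 0 by case: (colC z) => // -[].
  have CC := rank1_columns rC colC'.
  pose z0 := Ordinal m0; have [p /F2_neq0 Cp] := colC' z0.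
  pose c (a : 'I_k + 'I_m) := match a with inl y => if y == p then 0 else C y z0
    | _ => 0 end.
  have step : affequiv R (glue (fun y z => C y z) (fun _ _ : 'I_m => 0))
      (glue (fun (y : 'I_k) (z : 'I_m) => (y == p)%:R) (fun _ _ => 0)).
    apply: (@affequiv_pivot R _ _ _ (inl p) c) => //=; first by rewrite eqxx.
      by move=> [y|z] //= _ [y'|z'].
    move=> [y|z] [y'|z'] //=; rewrite ?mulr0 ?addr0 ?mul0r ?addr0 //.
    rewrite (CC y z' z0) (CC p z' z0) Cp mulr1.
    by case: eqP => [->|_]; rewrite ?Cp ?addr0 ?F2D.
  apply: affequiv_trans step _.
  apply: (@affequiv_reindex R _ _ _ _ (fun a : 'I_k + 'I_m =>
    match a with inl y => inl (tperm y0 p y) | inr z => inr z end)).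
    exists (fun a : 'I_k + 'I_m => match a with inl y => inl (tperm y0 p y) |
      inr z => inr z end);
      by case=> // y; rewrite tpermK.
  move=> [y|z] [y'|z'] //=.
  by rewrite -{2}[p](tpermL y0 p) (inj_eq perm_inj).
- move=> A B c Am Bm; apply: affequiv_diffeo.
  exact: affequiv_trans Am (affequiv_sym Bm).
- by move=> A B c c' _ _ _; rewrite (ord1 c) (ord1 c').
- move=> _; pose C : 'M['F_2]_(k, m) := \matrix_(y, z) (y == y0)%:R.
  have CE : C = (delta_mx y0 0 : 'cV_k) *m (const_mx 1 : 'rV_m).
    by apply/matrixP => y z; rewrite !mxE big_ord1 !mxE eqxx andbT mulr1.
  have rC : \rank C = 1%N.
    have : (\rank C <= 1)%N.
      by rewrite CE; apply: leq_trans (mxrankM_maxl _ _) (rank_leq_col _).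
    have : (0 < \rank C)%N.
      rewrite lt0n mxrank_eq0; apply/eqP => /matrixP/(_ y0 (Ordinal m0)).
      by rewrite !mxE eqxx => /eqP; rewrite oner_eq0.
    lia.
  have [|tA [g gb gE]] :=
    twisted_product_intro (bott_matrix1 m) (is_torus1 R m) rC.
    by move=> z; left; exists y0; rewrite mxE eqxx; exact: F2_1_neq0.
  exists (block_mx 1%:M C 0 1%:M); split => //.
  apply: affequiv_trans (affequiv_reindex R gb gE) _.
  by apply: affequiv_eq => -[y|z] [y'|z'] //=; rewrite ?mxE ?bottN1.
Qed.

End Classification.

Theorem propositionC (R : realType) :
  (forall k : nat, (2 <= k)%N ->
     num_diffeo_classes R
       (twisted_product (k := 1) 1 (m := k + 2)
          (fun B => exists s : nat, (s = 1%N \/ s = 2%N) /\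
             twisted_product (k := k) s (m := 2) (@is_torus R 2) B))
     = 3%N
     /\
     num_diffeo_classes R
       (twisted_product (k := 1) 1 (m := k + 2)
          (fun B => exists s : nat, (s = 1%N \/ s = 2%N) /\
             twisted_product (k := k) s (m := 2) (@is_klein_bottle R) B))
     = 3%N)
  /\
  (forall t : nat, (2 <= t)%N ->
     num_diffeo_classes R
       (twisted_product (k := 1) 1 (m := 1 + t)
          (fun B => twisted_product (k := 1) 1 (m := t) (@is_torus R t) B))
     = (t./2 + 1)%N)
  /\
  (forall n k : nat, (2 <= n)%N -> (1 <= k)%N -> (k <= n - 1)%N ->
     num_diffeo_classes R
       (twisted_product (k := k) 1 (m := n - k) (@is_torus R (n - k)))
     = 1%N).
Proof.
split; first by move=> k k2; split; [exact: torus_classes|exact: klein_classes].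
split; first exact: line_classes.
by move=> n k n2 k1 kn; apply: bundle_class => //; lia.
Qed.
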